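(* Let $(\mathcal{M},g_{ab})$ be a smooth oriented four-dimensional Lorentzian manifold with $R_{ab}=0$, let $K^a$ be a Killing vector field, and let the nonlinear electromagnetic Lagrangian density be of the form $$\mathscr{L}(\mathcal{F},\mathcal{G}) = -\tfrac14\mathcal{F} + \lambda\,\ell(\mathcal{F},\mathcal{G}) + O(\lambda^2)$$ with $\ell$ a smooth function of two variables. Let $v_a$ be a smooth 1-form, and let $F = \mathrm{d}A$ with $A_a = K_a + \lambda v_a + O(\lambda^2)$. Then $\mathrm{d}F=0$, and the equation $\mathrm{d}{*Z}=0$ holds up to terms of order $O(\lambda^2)$ if and only if $v$ satisfies $$\mathrm{d}{*\mathrm{d}}v = {*J}_{\mathrm{eff}},$$ where $${*J}_{\mathrm{eff}} = 4\left(\ell_{\mathcal{F}\mathcal{F}}\,\mathrm{d}\mathcal{F}+\ell_{\mathcal{F}\mathcal{G}}\,\mathrm{d}\mathcal{G}\right)_0\wedge{*\mathrm{d}}K - 4\left(\ell_{\mathcal{G}\mathcal{F}}\,\mathrm{d}\mathcal{F}+\ell_{\mathcal{G}\mathcal{G}}\,\mathrm{d}\mathcal{G}\right)_0\wedge\mathrm{d}K .$$ Moreover, ${*J}_{\mathrm{eff}}$ is a closed 3-form, $\mathrm{d}{*J}_{\mathrm{eff}}=0$.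
   Context: For a 2-form $F_{ab}$, the electromagnetic invariants are $\mathcal{F}=F_{ab}F^{ab}$ and $\mathcal{G}=F_{ab}\,{*F}^{ab}$. The Hodge dual of a $p$-form in dimension $m$ is $( *\omega)_{a_{p+1}\dots a_m}=\frac{1}{p!}\omega_{a_1\dots a_p}\epsilon^{a_1\dots a_p}{}_{a_{p+1}\dots a_m}$, so $**F=-F$ for 2-forms in four Lorentzian dimensions. Subscripts on functions of $(\mathcal{F},\mathcal{G})$ denote partial derivatives, e.g. $\ell_{\mathcal{F}\mathcal{G}}=\partial_{\mathcal{G}}\partial_{\mathcal{F}}\ell$. The auxiliary 2-form is $Z=-4(\mathscr{L}_{\mathcal{F}}\,F+\mathscr{L}_{\mathcal{G}}\,{*F})$, and the source-free nonlinear Maxwell equations are $\mathrm{d}F=0$ and $\mathrm{d}{*Z}=0$. The Killing 1-form is $K_a=g_{ab}K^b$, also denoted $K$. The subscript $0$ on a bracket means that the quantities in it are evaluated for the field $F_0=\mathrm{d}K$. Expansions in the real coupling parameter $\lambda$ are around $\lambda=0$, with smooth dependence on $\lambda$ (the $O(\lambda^2)$ terms may be differentiated with respect to the other variables and remain $O(\lambda^2)$). The metric $g_{ab}$ is a fixed background independent of $\lambda$ (test field). *)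

(* Defs.v *)
From HB Require Import structures.
From mathcomp Require Import all_boot all_order all_algebra.
From mathcomp Require Import all_classical all_reals all_analysis.
Set Implicit Arguments.
Unset Strict Implicit.
Unset Printing Implicit Defensive.
Import Order.TTheory GRing.Theory Num.Theory.
Import numFieldNormedType.Exports.
Local Open Scope classical_set_scope.
Local Open Scope ring_scope.

Section Calculus.
Context {R : realType} {n : nat}.
Implicit Types (f : 'rV[R]_n -> R) (U : set 'rV[R]_n).

Definition pd (i : 'I_n) f : 'rV[R]_n -> R :=
  fun x => 'D_(delta_mx ord0 i) f x.

Definition pds (s : seq 'I_n) f : 'rV[R]_n -> R := foldr pd f s.

(* C^oo on an open set [U]: all iterated partial derivatives exist and are
   continuous at the points of [U]; values outside [U] are irrelevant. *)
Definition smooth_on U f :=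
  forall (s : seq 'I_n) x, U x ->
    {for x, continuous (pds s f)} /\
    forall i, derivable (pds s f) x (delta_mx ord0 i).

End Calculus.

(* Joint smoothness in (lambda, x): lambda is the first of the 1 + n
   coordinates. *)
Definition smooth_family_on {R : realType} {n : nat} (D : set (R * 'rV[R]_n))
    (f : R -> 'rV[R]_n -> R) :=
  smooth_on [set z : 'rV[R]_(1 + n) | D (lsubmx z ord0 ord0, rsubmx z)]
            (fun z : 'rV[R]_(1 + n) => f (lsubmx z ord0 ord0) (rsubmx z)).

(* f(lambda, x) = O(lambda^2) as lambda -> 0, locally uniformly in x in U and
   after any number of differentiations with respect to x. *)
Definition Olambda2 {R : realType} {n : nat} (U : set 'rV[R]_n)
    (f : R -> 'rV[R]_n -> R) :=
  forall (s : seq 'I_n) x, U x ->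
    exists C : R, \forall z \near ((0 : R), x),
      `|pds s (f z.1) z.2| <= C * z.1 ^+ 2.

(* A smooth oriented n-manifold, given by an oriented atlas: a Hausdorff second
   countable space covered by charts with smooth transition maps of positive
   Jacobian determinant. *)
Record oriented_manifold (R : realType) (n : nat) := OrientedManifold {
  points : topologicalType;
  chart_index : Type;
  chart_dom : chart_index -> set points;
  chart : chart_index -> points -> 'rV[R]_n;
  param : chart_index -> 'rV[R]_n -> points;
  chart_codom := fun i => chart i @` chart_dom i;
  overlap := fun i j => chart i @` (chart_dom i `&` chart_dom j);
  transition := fun i j x => chart j (param i x);
  points_hausdorff : hausdorff_space points;
  points_second_countable : @second_countable points;
  chart_dom_open : forall i, open (chart_dom i);
  chart_codom_open : forall i, open (chart_codom i);
  chart_cover : forall p, exists i, chart_dom i p;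
  chartK : forall i p, chart_dom i p -> param i (chart i p) = p;
  chart_continuous : forall i p, chart_dom i p -> {for p, continuous (chart i)};
  param_continuous :
    forall i x, chart_codom i x -> {for x, continuous (param i)};
  transition_smooth : forall i j (a : 'I_n),
    smooth_on (overlap i j) (fun x => transition i j x ord0 a);
  transition_oriented : forall i j x, overlap i j x ->
    0 < \det (jacobian (transition i j) x)
}.

(* Tensor fields are families of component functions, one for each chart,
   related on overlaps by the tensor transformation law.  The library's
   [jacobian] acts on row vectors: its (a, b) entry is d x'^b / d x^a. *)
Section Fields.
Context {R : realType} {n : nat} (M : oriented_manifold R n).
Let I := chart_index M.
Let jac (i j : I) x := jacobian (transition (o := M) i j) x.

Definition covector_law (w : I -> 'I_n -> 'rV[R]_n -> R) :=
  forall i j x, overlap i j x -> forall a,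
    w i a x = \sum_b jac i j x a b * w j b (transition i j x).

Definition is_1form (w : I -> 'I_n -> 'rV[R]_n -> R) :=
  covector_law w /\ forall i a, smooth_on (chart_codom i) (w i a).

Definition is_1form_family (eps : R) (w : R -> I -> 'I_n -> 'rV[R]_n -> R) :=
  (forall la, `|la| < eps -> covector_law (w la)) /\
  forall i a,
    smooth_family_on [set z | `|z.1| < eps /\ chart_codom i z.2]
                     (fun la => w la i a).

Definition is_vector_field (X : I -> 'I_n -> 'rV[R]_n -> R) :=
  (forall i j x, overlap i j x -> forall b,
     X j b (transition i j x) = \sum_a X i a x * jac i j x a b) /\
  forall i a, smooth_on (chart_codom i) (X i a).

(* Signature (-, +, ..., +), by existence of an orthonormal frame. *)
Definition lorentzian_form (g : 'M[R]_n) :=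
  g^T = g /\
  exists2 P : 'M[R]_n, P \in unitmx &
    P *m g *m P^T =
      \matrix_(i, j) ((if val i == 0%N then -1 else 1) *+ (i == j)).

Definition is_lorentzian_metric (g : I -> 'rV[R]_n -> 'M[R]_n) :=
  [/\ forall i j x, overlap i j x ->
        g i x = jac i j x *m g j (transition i j x) *m (jac i j x)^T,
      forall i a b, smooth_on (chart_codom i) (fun x => g i x a b) &
      forall i x, chart_codom i x -> lorentzian_form (g i x)].

End Fields.

(* Coordinate expressions in a single chart; [g] is the matrix of covariant
   components of the metric. *)
Section ChartGeometry.
Context {R : realType} {n : nat}.
Local Notation scalar := ('rV[R]_n -> R).
Implicit Types (g : 'rV[R]_n -> 'M[R]_n) (X : 'I_n -> scalar).

Definition ginv g (a b : 'I_n) : scalar := fun x => invmx (g x) a b.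

Definition christoffel g (c a b : 'I_n) : scalar := fun x =>
  2^-1 * \sum_d ginv g c d x *
    (pd a (fun y => g y b d) x + pd b (fun y => g y a d) x
     - pd d (fun y => g y a b) x).

(* R^d_{c a b}, normalised by
   (nabla_a nabla_b - nabla_b nabla_a) X^d = R^d_{c a b} X^c. *)
Definition riemann g (d c a b : 'I_n) : scalar := fun x =>
  pd a (christoffel g d b c) x - pd b (christoffel g d a c) x
  + \sum_e (christoffel g d a e x * christoffel g e b c x
            - christoffel g d b e x * christoffel g e a c x).

Definition ricci g (a b : 'I_n) : scalar := fun x =>
  \sum_c riemann g c a c b x.

Definition lie_metric g X (a b : 'I_n) : scalar := fun x =>
  \sum_c (X c x * pd c (fun y => g y a b) x
          + g x c b * pd a (X c) x + g x a c * pd b (X c) x).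

Definition flat g X (a : 'I_n) : scalar := fun x => \sum_b g x a b * X b x.

(* A p-form is given by its (totally antisymmetric) components w_{a_1 ... a_p};
   d and the wedge product with a 1-form are normalised by (d w)_{a b ...} = (p + 1) d_[a w_{b ...]} and
   (u /\ w)_{a b ...} = (p + 1) u_[a w_{b ...]}. *)
Definition d0 (f : scalar) (a : 'I_n) : scalar := pd a f.

Definition d1 (A : 'I_n -> scalar) (a b : 'I_n) : scalar := fun x =>
  pd a (A b) x - pd b (A a) x.

Definition d2 (F : 'I_n -> 'I_n -> scalar) (a b c : 'I_n) : scalar := fun x =>
  pd a (F b c) x - pd b (F a c) x + pd c (F a b) x.

Definition d3 (W : 'I_n -> 'I_n -> 'I_n -> scalar) (a b c d : 'I_n) : scalar :=
  fun x => pd a (W b c d) x - pd b (W a c d) x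
           + pd c (W a b d) x - pd d (W a b c) x.

Definition wedge12 (u : 'I_n -> scalar) (F : 'I_n -> 'I_n -> scalar)
    (a b c : 'I_n) : scalar := fun x =>
  u a x * F b c x - u b x * F a c x + u c x * F a b x.

Definition raise2 g (F : 'I_n -> 'I_n -> scalar) (a b : 'I_n) : scalar :=
  fun x => \sum_c \sum_d ginv g a c x * ginv g b d x * F c d x.

End ChartGeometry.

Section Electrodynamics.
Context {R : realType}.
Local Notation scalar := ('rV[R]_4 -> R).
Implicit Types (g : 'rV[R]_4 -> 'M[R]_4) (F : 'I_4 -> 'I_4 -> scalar).

(* The determinant is the Levi-Civita symbol of (a, b, c, d), charts being
   positively oriented. *)
Definition volume_form g (a b c d : 'I_4) : scalar := fun x =>
  Num.sqrt `|\det (g x)| *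
  \det (\matrix_(i < 4, j < 4) (tnth [tuple a; b; c; d] i == j)%:R : 'M[R]_4).

Definition hodge2 g F (a b : 'I_4) : scalar := fun x =>
  2^-1 * \sum_c \sum_d raise2 g F c d x * volume_form g c d a b x.

Definition invF g F : scalar := fun x =>
  \sum_a \sum_b F a b x * raise2 g F a b x.

Definition invG g F : scalar := fun x =>
  \sum_a \sum_b F a b x * raise2 g (hodge2 g F) a b x.

(* Functions of the invariants are functions on 'rV_2 whose coordinates are
   (calF, calG). *)
Definition invs g F : 'rV[R]_4 -> 'rV[R]_2 := fun x =>
  \row_(k < 2) (if k == ord0 then invF g F x else invG g F x).

Definition dcalF (l : 'rV[R]_2 -> R) : 'rV[R]_2 -> R := pd ord0 l.
Definition dcalG (l : 'rV[R]_2 -> R) : 'rV[R]_2 -> R := pd ord_max l.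

Definition Zform g (L : 'rV[R]_2 -> R) F (a b : 'I_4) : scalar := fun x =>
  - 4 * (dcalF L (invs g F x) * F a b x
         + dcalG L (invs g F x) * hodge2 g F a b x).

(* The 3-form *J_eff, with F0 = dK. *)
Definition starJeff g (l : 'rV[R]_2 -> R) (K : 'I_4 -> scalar)
    (a b c : 'I_4) : scalar :=
  let F0 := d1 K in
  let dF := d0 (invF g F0) in
  let dG := d0 (invG g F0) in
  let u1 (e : 'I_4) x := dcalF (dcalF l) (invs g F0 x) * dF e x
                         + dcalG (dcalF l) (invs g F0 x) * dG e x in
  let u2 (e : 'I_4) x := dcalF (dcalG l) (invs g F0 x) * dF e x
                         + dcalG (dcalG l) (invs g F0 x) * dG e x in
  fun x => 4 * wedge12 u1 (hodge2 g F0) a b c x - 4 * wedge12 u2 F0 a b c x.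

End Electrodynamics.

(* Main.v *)
(** Everything is local, so a single chart suffices.  The invariants
    [P = L_F] and [Q = L_G] evaluated on [F = dA] are smooth in [(lambda, x)],
    and [**F = -F] turns the field equation into [d N = 0] with
    [N = -4 (P *F - Q F)].  By Taylor's formula, [d N] is [O(lambda^2)], together
    with all its derivatives in [x], iff it vanishes at [lambda = 0] along with
    its [lambda]-derivative.  At [lambda = 0], [P = -1/4] and [Q = 0], so
    [d N = d*dK], and this is zero because [nabla_a nabla^a K^b = - R^b_a K^a].
    The [lambda]-derivative of [N] is [*dv - 4 (l_F *dK - l_G dK)], and since
    [dK] and [*dK] are closed, [*J_eff = d (4 l_F *dK - 4 l_G dK)]: this gives
    both the equation for [v] and the closedness of [*J_eff]. *)

Require Import Defs.
From mathcomp Require Import all_boot all_order all_algebra.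
From mathcomp Require Import all_classical all_reals all_analysis.
From mathcomp Require Import perm ring lra.
Import Order.TTheory GRing.Theory Num.Theory.
Import numFieldNormedType.Exports.
Local Open Scope classical_set_scope.
Local Open Scope ring_scope.
Set Implicit Arguments.
Unset Strict Implicit.
Unset Printing Implicit Defensive.

(** * Partial derivatives *)

Section PartialDerivatives.
Context {R : realType}.

(** Smoothness is given by existence and continuity of iterated partial derivatives, so the calculus
    rests on the mean value theorem along coordinate lines: it yields the chain rule, the symmetry
    of second derivatives and Taylor's formula. Families are functions of 1 + n variables with
    lambda as one of them; commuting d with the lambda-derivative is then an instance of that
    symmetry. The expansions of L and A become identities between functions, for the value and the
    lambda-derivative at 0, and these can be differentiated. The range of lambda on which L is
    smooth may shrink as the invariants vary, so the families built from it live on an open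
    neighbourhood of lambda = 0 without uniform width; this is enough because the O(lambda^2) bounds
    are local in x. The source of the equation for v does not involve v because L_F and L_G are
    constant at lambda = 0: varying the invariants contributes nothing at first order. *)

Lemma is_derive_line n (f : 'rV[R]_n -> R) x v (s : R) :
  derivable f (x + s *: v) v ->
  is_derive s 1 (fun h : R => f (x + h *: v)) ('D_v f (x + s *: v)).
Proof.
have E : (fun h : R => h^-1 *: (((fun h : R => f (x + h *: v)) \o shift s) (h *: 1)
           - f (x + s *: v)))
    = (fun h : R => h^-1 *: ((f \o shift (x + s *: v)) (h *: v) - f (x + s *: v))).
  apply/funext => h /=; congr (_ *: (f _ - _)).
  by rewrite [h *: 1]mulr1 scalerDl addrCA.
by move=> df; split; rewrite /derivable /derive E.
Qed.

(** The intermediate point is located only by [|s| <= |t|], which treats both signs of t and t = 0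
    alike and suffices to keep it in a coordinate box. *)
Lemma line_mvt n (f : 'rV[R]_n -> R) x v (t : R) :
  (forall s : R, `|s| <= `|t| -> derivable f (x + s *: v) v) ->
  exists2 s : R, `|s| <= `|t| & f (x + t *: v) - f x = t * 'D_v f (x + s *: v).
Proof.
move=> df; pose g (h : R) := f (x + h *: v).
have dg (s : R) : `|s| <= `|t| -> is_derive s 1 g ('D_v f (x + s *: v)).
  by move=> /df; exact: is_derive_line.
have g0 : g 0 = f x by rewrite /g scale0r addr0.
case: (leP 0 t) => t0.
- have bnd (s : R) : s \in `[0, t]%R -> `|s| <= `|t|.
    by rewrite in_itv /= => /andP[s0 st]; rewrite !ger0_norm.
  have [||s sI E] := @MVT_segment R g (fun s : R => 'D_v f (x + s *: v)) 0 t t0.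
  + by move=> s /subset_itv_oo_cc sI; apply: dg; exact: bnd.
  + apply: derivable_within_continuous => s sI.
    by have [] := dg _ (bnd _ sI).
  by exists s; [exact: bnd|rewrite -/(g t) -g0 E subr0 mulrC].
- have bnd (s : R) : s \in `[t, 0]%R -> `|s| <= `|t|.
    by rewrite in_itv /= => /andP[ts s0]; rewrite !ler0_norm ?lerN2// ltW.
  have [||s sI E] := @MVT_segment R g (fun s : R => 'D_v f (x + s *: v)) t 0 (ltW t0).
  + by move=> s /subset_itv_oo_cc sI; apply: dg; exact: bnd.
  + apply: derivable_within_continuous => s sI.
    by have [] := dg _ (bnd _ sI).
  exists s; [exact: bnd|rewrite -/(g t) -g0 -opprB E sub0r]; ring.
Qed.

(** Boxes are the convenient neighbourhoods here: replacing some coordinates of a point by those of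
    the centre does not leave the box. *)
Lemma nbhs_rVP n (x : 'rV[R]_n) (P : set 'rV[R]_n) :
  nbhs x P <-> exists2 r : R, 0 < r &
    forall y : 'rV[R]_n, (forall j, `|y ord0 j - x ord0 j| < r) -> P y.
Proof.
split=> [/nbhs_ballP [r r0 rP]|[r r0 rP]].
  exists r => // y yr; apply: rP; split => // i j.
  by rewrite ord1 /ball /= distrC.
apply/nbhs_ballP; exists r => // y [_ yr]; apply: rP => j.
by rewrite distrC; exact: yr.
Qed.

Lemma delta_rVE n (j i : 'I_n) : (delta_mx ord0 j : 'rV[R]_n) ord0 i = (i == j)%:R.
Proof. by rewrite mxE eqxx. Qed.

(* [q j y] is the j-th partial derivative at an intermediate point. *)
Lemma caratheodory n (f : 'rV[R]_n -> R) (x : 'rV[R]_n) :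
  (forall j, \forall y \near x, derivable f y (delta_mx ord0 j)) ->
  (forall j, {for x, continuous (pd j f)}) ->
  exists q : 'I_n -> 'rV[R]_n -> R,
    (forall j, q j @ x --> pd j f x) /\
    \forall y \near x, f y - f x = \sum_j (y ord0 j - x ord0 j) * q j y.
Proof.
move=> df cf.
have [r r0 dfr] : exists2 r : R, 0 < r &
    forall y : 'rV[R]_n, (forall j, `|y ord0 j - x ord0 j| < r) ->
      forall j, derivable f y (delta_mx ord0 j).
  have : \forall y \near x, forall j, derivable f y (delta_mx ord0 j).
    exact: (filter_forall (nbhs_filter x) df).
  by move/nbhs_rVP.
(* The hybrid point has its first k coordinates from y and the others from x. Consecutive hybrids
   differ in one coordinate, and the increment of f from x to y telescopes along them. *)
pose hyb (y : 'rV[R]_n) k : 'rV[R]_n := \row_j (if (j < k)%N then y ord0 j else x ord0 j).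
have hybS y (j : 'I_n) :
    hyb y j.+1 = hyb y j + (y ord0 j - x ord0 j) *: delta_mx ord0 j.
  apply/rowP => i; rewrite !mxE eqxx /= ltnS leq_eqVlt val_eqE.
  have [->|ij] := eqVneq i j; first by rewrite ltnn mulr1 addrCA subrr addr0.
  by rewrite mulr0 addr0.
have mid (j : 'I_n) (y : 'rV[R]_n) : exists p : 'rV[R]_n, (forall i, `|p ord0 i - x ord0 i| <= `|y ord0 i - x ord0 i|) /\
    ((forall j, `|y ord0 j - x ord0 j| < r) ->
     f (hyb y j.+1) - f (hyb y j) = (y ord0 j - x ord0 j) * pd j f p).
  have bd (s : R) i : `|s| <= `|y ord0 j - x ord0 j| ->
     `|(hyb y j + s *: delta_mx ord0 j) ord0 i - x ord0 i| <= `|y ord0 i - x ord0 i|.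
    move=> sy; rewrite !mxE eqxx /=.
    have [->|ij] := eqVneq i j; first by rewrite ltnn mulr1 addrAC subrr add0r.
    by rewrite mulr0 addr0; case: ifP => _ //; rewrite subrr normr0.
  (* Outside the box nothing is claimed about f, and y itself serves as the point; this makes the
     choice of [p] total. *)
  have [yr|nyr] := pselect (forall j, `|y ord0 j - x ord0 j| < r); last first.
    by exists y; split=> // /nyr.
  have [s ss E] := @line_mvt n f (hyb y j) (delta_mx ord0 j) (y ord0 j - x ord0 j)
    (fun s ss => dfr _ (fun i => le_lt_trans (bd s i ss) (yr i)) j).
  exists (hyb y j + s *: delta_mx ord0 j); split; first by move=> i; exact: bd.
  by move=> _; rewrite hybS E.
pose p (j : 'I_n) (y : 'rV[R]_n) := sval (cid (mid j y)).
exists (fun j y => pd j f (p j y)); split.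
  (* In each coordinate the intermediate point is no farther from x than y is, so a box that works
     for [pd j f] works for [q j]. *)
  move=> j; apply/(@cvgrPdist_lt _ _ _ (nbhs x) (nbhs_filter x)) => e e0.
  have /(@cvgrPdist_lt _ _ _ (nbhs x) (nbhs_filter x))/(_ _ e0)/nbhs_rVP[d d0 dP] := cf j.
  apply/nbhs_rVP; exists d => // y yd; apply: dP => i.
  rewrite /p; case: cid => /= q [qy _]; exact: le_lt_trans (qy i) (yd i).
apply/nbhs_rVP; exists r => // y yr.
under eq_bigr => j _.
  rewrite -(proj2 (svalP (cid (mid j y))) yr).
  over.
rewrite -(big_mkord xpredT (fun k => f (hyb y k.+1) - f (hyb y k))) telescope_sumr //.
congr (f _ - f _); apply/rowP => i; rewrite mxE ?ltn_ord //.
Qed.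

Lemma cvg_sum_ord (T : Type) (F : set_system T) {FF : Filter F} m
    (f : 'I_m -> T -> R) (a : 'I_m -> R) :
  (forall j, f j x @[x --> F] --> a j) ->
  \sum_j f j x @[x --> F] --> \sum_j a j.
Proof.
by move=> fa; apply: (cvg_big (@add_continuous R)) => // j _; exact: fa.
Qed.

(** By [caratheodory] the difference quotient of f o phi is a finite sum of values of [q j] along
    phi times difference quotients of the components of phi, and the limit can be taken termwise. *)
Lemma derive_chain n m (f : 'rV[R]_m -> R) (phi : 'rV[R]_n -> 'rV[R]_m) x v :
  (forall j, \forall y \near phi x, derivable f y (delta_mx ord0 j)) ->
  (forall j, {for phi x, continuous (pd j f)}) ->
  (forall j, derivable (fun y => phi y ord0 j) x v) ->
  is_derive x v (f \o phi)
    (\sum_j pd j f (phi x) * 'D_v (fun y => phi y ord0 j) x).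
Proof.
move=> df cf dphi.
have [q [qc qE]] := caratheodory df cf.
(* Derivability of the components in the direction v gives continuity of phi along the line x + h v,
   which is all that a limit in h sees. *)
have phic : phi (h *: v + x) @[h --> 0^'] --> phi x.
  move=> P /nbhs_rVP[e e0 eP].
  have H (j : 'I_m) : \forall h \near (0:R)^', `|phi (h *: v + x) ord0 j - phi x ord0 j| < e.
    have /derivable1P/derivable1_diffP/differentiable_continuous := dphi j.
    move=> /continuous_withinNx; rewrite scale0r add0r => /cvgrPdist_lt/(_ e e0).
    by apply: filterS => h; rewrite distrC.
  have := filter_forall (dnbhs_filter 0) H.
  apply: filterS => h hj; exact: eP.
have C : h^-1 *: (((f \o phi) \o shift x) (h *: v) - (f \o phi) x) @[h --> 0^'] -->
    \sum_j pd j f (phi x) * 'D_v (fun y => phi y ord0 j) x.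
  have E : \forall h \near (0:R)^',
     \sum_j q j (phi (h *: v + x)) * (h^-1 *: (phi (h *: v + x) ord0 j - phi x ord0 j)) =
     h^-1 *: (((f \o phi) \o shift x) (h *: v) - (f \o phi) x).
    have qE' : \forall h \near (0:R)^', f (phi (h *: v + x)) - f (phi x) =
        \sum_j (phi (h *: v + x) ord0 j - phi x ord0 j) * q j (phi (h *: v + x)).
      exact: (phic _ qE).
    apply: filterS qE' => h /= ->.
    rewrite scaler_sumr; apply: eq_bigr => j _.
    by rewrite mulrC -scalerAl.
  apply: cvg_trans (near_eq_cvg E) _.
  apply: (@cvg_sum_ord _ _ _ _ (fun j h => q j (phi (h *: v + x)) *
    (h^-1 *: (phi (h *: v + x) ord0 j - phi x ord0 j)))) => j.
  apply: cvgM; first exact: (cvg_comp _ _ phic (qc j)).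
  exact: (dphi j).
split; first by apply/cvg_ex; eexists; exact: C.
exact: cvg_lim C.
Qed.

End PartialDerivatives.

(** * Symmetry of second derivatives and closure properties of smooth functions *)

Section Smooth.
Context {R : realType} {n : nat}.
Implicit Types (f g : 'rV[R]_n -> R) (U : set 'rV[R]_n) (x v w : 'rV[R]_n).

Lemma quotient_translate f v w x :
  (fun h : R => h^-1 *: (((fun y => f (y + w)) \o shift x) (h *: v) - f (x + w)))
  = (fun h : R => h^-1 *: ((f \o shift (x + w)) (h *: v) - f (x + w))).
Proof. by apply/funext => h /=; rewrite addrA. Qed.

Lemma derivable_translate f v w x :
  derivable f (x + w) v -> derivable (fun y => f (y + w)) x v.
Proof. by rewrite /derivable quotient_translate. Qed.

Lemma derive_translate f v w x : 'D_v (fun y => f (y + w)) x = 'D_v f (x + w).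
Proof. by rewrite /derive quotient_translate. Qed.

(** The second difference over a square of side t is symmetric in i and j, while the mean value
    theorem, applied twice, evaluates it by a mixed partial derivative in a chosen order. The margin
    [t + t < r] covers i = j, where both displacements fall on one coordinate. *)
Lemma second_difference f (i j : 'I_n) x (r t : R) :
  0 < t -> t + t < r ->
  (forall y : 'rV[R]_n, (forall k, `|y ord0 k - x ord0 k| < r) ->
     derivable f y (delta_mx ord0 i) /\ derivable (pd i f) y (delta_mx ord0 j)) ->
  exists2 p : 'rV[R]_n, (forall k, `|p ord0 k - x ord0 k| < r) &
    f (x + t *: delta_mx ord0 i + t *: delta_mx ord0 j) - f (x + t *: delta_mx ord0 i)
    - f (x + t *: delta_mx ord0 j) + f x = t * (t * pd j (pd i f) p).
Proof.
move=> t0 tr df.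
set ei : 'rV[R]_n := delta_mx ord0 i; set ej : 'rV[R]_n := delta_mx ord0 j.
have box (s s' : R) k : `|s| <= `|t| -> `|s'| <= `|t| ->
    `|(x + s *: ei + s' *: ej) ord0 k - x ord0 k| < r.
  rewrite (gtr0_norm t0) => st st'; apply: le_lt_trans tr.
  rewrite !mxE eqxx /= [X in `|X|](_ : _ = s * (k == i)%:R + s' * (k == j)%:R); last by ring.
  apply: le_trans (ler_normD _ _) (lerD _ _); rewrite normrM.
    by case: (k == i); rewrite ?normr1 ?normr0 ?mulr1 ?mulr0// ltW.
  by case: (k == j); rewrite ?normr1 ?normr0 ?mulr1 ?mulr0// ltW.
have box0 (s : R) k : `|s| <= `|t| -> `|(x + s *: ei) ord0 k - x ord0 k| < r.
  by move=> st; have := box s 0 k st; rewrite scale0r addr0 normr0; apply.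
have [|s st E] := @line_mvt R n (fun y => f (y + t *: ej) - f y) x ei t.
  move=> s st; apply: derivableB; last by apply: (df _ _).1 => k; exact: box0.
  by apply: derivable_translate; apply: (df _ _).1 => k; exact: box.
have [|s' st' E'] := @line_mvt R n (pd i f) (x + s *: ei) ej t.
  by move=> s' st'; apply: (df _ _).2 => k; exact: box.
exists (x + s *: ei + s' *: ej); first by move=> k; exact: box.
have -> : pd j (pd i f) (x + s *: ei + s' *: ej) = 'D_ej (pd i f) (x + s *: ei + s' *: ej) by [].
rewrite -E' /pd -[delta_mx ord0 i]/ei.
have -> : 'D_ei f (x + s *: ei + t *: ej) - 'D_ei f (x + s *: ei) =
    'D_ei (fun y => f (y + t *: ej) - f y) (x + s *: ei).
  rewrite deriveB ?derive_translate //; last by apply: (df _ _).1 => k; exact: box0.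
  by apply: derivable_translate; apply: (df _ _).1 => k; exact: box.
rewrite -E; ring.
Qed.

Lemma open_near U x : open U -> U x -> \forall y \near x, U y.
Proof. by move=> /[swap] Ux; rewrite openE => /(_ x Ux). Qed.

Lemma pd_ext U f g i x : open U -> U x -> (forall y, U y -> f y = g y) ->
  pd i f x = pd i g x.
Proof.
move=> oU Ux fg; apply: near_eq_derive.
by apply: filterS (open_near oU Ux) => y /fg.
Qed.

Lemma pds_rcons (s : seq 'I_n) i f : pds (rcons s i) f = pds s (pd i f).
Proof. by rewrite /pds foldr_rcons. Qed.

Lemma pds_ext U f g s x : open U -> (forall y, U y -> f y = g y) -> U x ->
  pds s f x = pds s g x.
Proof.
by move=> oU fg; elim: s x => [|i s IH] x Ux /=; [exact: fg|exact: (pd_ext i oU Ux)].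
Qed.

Lemma smooth_continuous U f x : smooth_on U f -> U x -> {for x, continuous f}.
Proof. by move=> sf Ux; have [] := sf [::] x Ux. Qed.

Lemma smooth_derivable U f x i : smooth_on U f -> U x ->
  derivable f x (delta_mx ord0 i).
Proof. by move=> sf Ux; have [_] := sf [::] x Ux. Qed.

Lemma smooth_pd U f i : smooth_on U f -> smooth_on U (pd i f).
Proof. by move=> sf s x Ux; rewrite -pds_rcons; exact: sf. Qed.

Lemma smooth_pds U f s : smooth_on U f -> smooth_on U (pds s f).
Proof. move=> sf; elim: s => [|i s IH]; [exact: sf|exact: smooth_pd IH]. Qed.

Lemma smooth_subset U V f : V `<=` U -> smooth_on U f -> smooth_on V f.
Proof. by move=> VU sf s x /VU Ux; exact: sf. Qed.

(** Schwarz's theorem: by [second_difference] in both orders, the two mixed partials take a common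
    value, at possibly different points p and q of a small box; continuity at x brings both points
    back to x. *)
Lemma pd_comm U f i j x : open U -> smooth_on U f -> U x ->
  pd i (pd j f) x = pd j (pd i f) x.
Proof.
move=> oU sf Ux.
apply/eqP; rewrite -subr_eq0 -normr_le0; apply/ler_addgt0Pr => e e0; rewrite add0r.
have e20 : 0 < e / 2 by rewrite divr_gt0.
have nr k l : \forall y \near x, `|pd k (pd l f) x - pd k (pd l f) y| < e / 2.
  have := smooth_continuous (smooth_pd k (smooth_pd l sf)) Ux.
  by move/(@cvgrPdist_lt _ _ _ (nbhs x) (nbhs_filter x))/(_ _ e20).
have : \forall y \near x, U y /\ (`|pd i (pd j f) x - pd i (pd j f) y| < e / 2 /\
    `|pd j (pd i f) x - pd j (pd i f) y| < e / 2).
  exact: filterI (open_near oU Ux) (filterI (nr i j) (nr j i)).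
move=> /nbhs_rVP[r r0 rP].
have t0 : 0 < r / 3 by rewrite divr_gt0.
have tr : r / 3 + r / 3 < r by lra.
have [p /rP[_ [_ pP]] pE] := @second_difference f i j x r (r / 3) t0 tr
  (fun y yr => conj (smooth_derivable sf (rP y yr).1)
                    (smooth_derivable (smooth_pd i sf) (rP y yr).1)).
have [q /rP[_ [qP _]] qE] := @second_difference f j i x r (r / 3) t0 tr
  (fun y yr => conj (smooth_derivable sf (rP y yr).1)
                    (smooth_derivable (smooth_pd j sf) (rP y yr).1)).
have pq : pd i (pd j f) q = pd j (pd i f) p.
  apply: (mulfI (lt0r_neq0 t0)); apply: (mulfI (lt0r_neq0 t0)).
  have swap (a b c d : R) : a - b - c + d = a - c - b + d by ring.
  apply: etrans (esym qE) _; apply: etrans _ pE.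
  by rewrite (addrAC x (r / 3 *: delta_mx ord0 j) (r / 3 *: delta_mx ord0 i)) swap.
have -> : pd i (pd j f) x - pd j (pd i f) x =
   (pd i (pd j f) x - pd i (pd j f) q) - (pd j (pd i f) x - pd j (pd i f) p).
  by rewrite pq opprB addrA subrK.
apply: le_trans (ler_normB _ _) _; rewrite [leRHS]splitr.
by apply: lerD; apply: ltW; [exact: qP|exact: pP].
Qed.

(* [smooth_on] quantifies over all iterated derivatives at once; its closure under
   products, inverses and compositions is proved by induction on the order [k]. *)
Fixpoint Ck (k : nat) U f : Prop :=
  (forall x, U x -> {for x, continuous f}) /\
  if k is k'.+1 then
    (forall i x, U x -> derivable f x (delta_mx ord0 i)) /\
    (forall i, Ck k' U (pd i f))
  else True.

Lemma Ck_continuous k U f x : Ck k U f -> U x -> {for x, continuous f}.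
Proof. by case: k => [|k] [+ _]; apply. Qed.

Lemma Ck_pred k U f : Ck k.+1 U f -> Ck k U f.
Proof.
elim: k f => [|k IH] f; first by case.
by case=> cf [df pf]; split=> //; split=> // i; exact: IH.
Qed.

Lemma smooth_onP U f : smooth_on U f <-> forall k, Ck k U f.
Proof.
split=> [sf k|cf].
  elim: k f sf => [|k IH] f sf.
    by split; [move=> x Ux; exact: smooth_continuous sf Ux|].
  split; first by move=> x Ux; exact: smooth_continuous sf Ux.
  split=> [i x Ux|i]; first exact: smooth_derivable sf Ux.
  by apply: IH; exact: smooth_pd.
(* Each derivative in s uses up one order, so k has to stay universally quantified in the induction
   on s. *)
have H s k : Ck k U (pds s f).
  elim: s k => [|i s IH] k; first exact: cf.
  by have [_ [_]] := IH k.+1; exact.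
move=> s x Ux; have [c [d _]] := H s 1%N; split; first exact: c.
by move=> i; exact: d.
Qed.

Lemma continuous_ext U f g x : open U -> (forall y, U y -> f y = g y) -> U x ->
  {for x, continuous f} -> {for x, continuous g}.
Proof.
move=> oU fg Ux cf; have E : \near x, f x = g x.
  by apply: filterS (open_near oU Ux) => y /fg.
suff : g @ x --> g x by [].
by rewrite -(fg _ Ux); exact: cvg_trans (near_eq_cvg E) cf.
Qed.

Lemma Ck_ext k U f g : open U -> (forall x, U x -> f x = g x) -> Ck k U f -> Ck k U g.
Proof.
move=> oU; elim: k f g => [|k IH] f g fg.
  by case=> cf _; split=> // x Ux; exact: (continuous_ext oU fg Ux (cf x Ux)).
case=> cf [df pf]; split; last split.
- by move=> x Ux; exact: (continuous_ext oU fg Ux (cf x Ux)).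
- move=> i x Ux; apply: near_eq_derivable (df i x Ux).
  by apply: filterS (open_near oU Ux) => y /fg.
- by move=> i; apply: IH (pf i) => x Ux; exact: (pd_ext i oU Ux fg).
Qed.

Lemma smooth_ext U f g : open U -> (forall x, U x -> f x = g x) ->
  smooth_on U f -> smooth_on U g.
Proof. by move=> oU fg /smooth_onP sf; apply/smooth_onP => k; exact: Ck_ext (sf k). Qed.

Lemma pd_cst i (c : R) x : pd i (fun _ => c) x = 0.
Proof. exact: derive_cst. Qed.

Lemma Ck_cst k U (c : R) : Ck k U (fun _ => c).
Proof.
elim: k c => [|k IH] c; split=> //; try by move=> x Ux; exact: cst_continuous.
split=> [i x Ux|i]; first exact: derivable_cst.
by rewrite (_ : pd i _ = fun=> 0)//; apply/funext => x; exact: pd_cst.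
Qed.

Lemma Ck_add k U f g : open U -> Ck k U f -> Ck k U g -> Ck k U (fun x => f x + g x).
Proof.
move=> oU; elim: k f g => [|k IH] f g [cf df] [cg dg]; split=> //.
- by move=> x Ux; exact: (continuousD (cf x Ux) (cg x Ux)).
- by move=> x Ux; exact: (continuousD (cf x Ux) (cg x Ux)).
case: df dg => df pf [dg pg]; split=> [i x Ux|i].
  by apply: derivableD; [exact: df|exact: dg].
apply: Ck_ext oU _ (IH _ _ (pf i) (pg i)) => x Ux.
by rewrite /pd deriveD //; [exact: df|exact: dg].
Qed.

Lemma Ck_mul k U f g : open U -> Ck k U f -> Ck k U g -> Ck k U (fun x => f x * g x).
Proof.
move=> oU; elim: k f g => [|k IH] f g hf hg.
  by split=> // x Ux; exact: (continuousM (Ck_continuous hf Ux) (Ck_continuous hg Ux)).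
split=> [x Ux|]; first by exact: (continuousM (Ck_continuous hf Ux) (Ck_continuous hg Ux)).
have [cf [df pf]] := hf; have [cg [dg pg]] := hg.
split=> [i x Ux|i]; first by apply: derivableM; [exact: df|exact: dg].
have := Ck_add oU (IH _ _ (Ck_pred hf) (pg i)) (IH _ _ (Ck_pred hg) (pf i)).
apply: Ck_ext => // x Ux.
by rewrite /pd deriveM //; [exact: df|exact: dg].
Qed.

Lemma Ck_sum k U m (f : 'I_m -> 'rV[R]_n -> R) : open U ->
  (forall j, Ck k U (f j)) -> Ck k U (fun x => \sum_j f j x).
Proof.
move=> oU; elim: m f => [|m IH] f hf.
  by apply: Ck_ext oU _ (Ck_cst k U 0) => x _; rewrite big_ord0.
apply: Ck_ext oU _ (Ck_add oU (IH _ (fun j => hf (widen_ord (leqnSn m) j))) (hf ord_max)).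
by move=> x _; rewrite big_ord_recr.
Qed.

(** The derivative of 1/f is -(1/f)(1/f) times that of f: it is built from 1/f itself, so the
    induction on the order closes. The same mechanism works for the square root in [Ck_sqrt]. *)
Lemma Ck_inv k U f : open U -> (forall x, U x -> f x != 0) ->
  Ck k U f -> Ck k U (fun x => (f x)^-1).
Proof.
move=> oU f0; elim: k => [|k IH] hf.
  by split=> // x Ux; exact: (continuousV (f0 x Ux) (Ck_continuous hf Ux)).
split=> [x Ux|]; first by exact: (continuousV (f0 x Ux) (Ck_continuous hf Ux)).
have [cf [df pf]] := hf; split=> [i x Ux|i].
  by apply: derivableV; [exact: f0|exact: df].
have h := IH (Ck_pred hf).
have := Ck_mul oU (Ck_cst k U (-1)) (Ck_mul oU (Ck_mul oU h h) (pf i)).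
apply: Ck_ext => // x Ux; rewrite /pd deriveV ?f0//; last exact: df.
by rewrite -exprVn -[LHS]/(-1 * _) mulN1r expr2 -[RHS]/(_ * _) mulNr.
Qed.

End Smooth.

Section SmoothClosure.
Context {R : realType} {n : nat}.
Implicit Types (f g : 'rV[R]_n -> R) (U : set 'rV[R]_n) (x v w : 'rV[R]_n).

Lemma pd_coord (i j : 'I_n) x : pd i (fun y : 'rV[R]_n => y ord0 j) x = (j == i)%:R.
Proof.
have E : (fun h : R => h^-1 *: (((fun y : 'rV[R]_n => y ord0 j) \o shift x)
      (h *: delta_mx ord0 i) - x ord0 j)) = fun h : R => h^-1 * (h * (j == i)%:R).
  by apply/funext => h /=; rewrite !mxE eqxx /= addrK.
rewrite /pd /derive E; apply/cvg_lim => //.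
apply: cvg_near_cst; near=> h; rewrite mulKf //.
by near: h; exact: nbhs_dnbhs_neq.
Unshelve. all: by end_near. Qed.

Lemma derivable_coord_rV (i j : 'I_n) x :
  derivable (fun y : 'rV[R]_n => y ord0 j) x (delta_mx ord0 i).
Proof. exact/diff_derivable/differentiable_coord. Qed.

Lemma Ck_coord k U (j : 'I_n) : Ck k U (fun y : 'rV[R]_n => y ord0 j).
Proof.
have c x : {for x, continuous (fun y : 'rV[R]_n => y ord0 j)} by exact: coord_continuous.
case: k => [|k]; split=> //; split=> [i x _|i]; first exact: derivable_coord_rV.
rewrite (_ : pd i _ = fun=> (j == i)%:R); first exact: Ck_cst.
by apply/funext => x; exact: pd_coord.
Qed.

Lemma sqrt_is_derive f x v : 0 < f x -> derivable f x v ->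
  is_derive x v (fun y => Num.sqrt (f y)) ('D_v f x * (2 * Num.sqrt (f x))^-1).
Proof.
move=> f0 /derivable1P df.
have E : (fun h : R => h^-1 *: (((fun y => Num.sqrt (f y)) \o shift x) (h *: v)
            - Num.sqrt (f x))) =
   (fun h : R => h^-1 *: (((Num.sqrt \o (fun h : R => f (h *: v + x))) \o shift 0) (h *: 1)
       - (Num.sqrt \o (fun h : R => f (h *: v + x))) 0)).
  by apply/funext => h /=; rewrite addr0 scale0r add0r [h *: 1]mulr1.
have g0 : 0 < (fun h : R => f (h *: v + x)) 0 by rewrite scale0r add0r.
have D := is_derive1_comp (is_derive1_sqrt g0) (derivableP df).
have E2 : 'D_1 (fun h : R => f (h *: v + x)) 0 = 'D_v f x.
  have Q : (fun h : R => h^-1 *: (((fun h : R => f (h *: v + x)) \o shift 0) (h *: 1)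
      - f (0 *: v + x))) = (fun h : R => h^-1 *: ((f \o shift x) (h *: v) - f x)).
    by apply/funext => h /=; rewrite addr0 scale0r add0r [h *: 1]mulr1.
  by rewrite /derive Q.
case: D => D1 D2; split; first by rewrite /derivable E.
have -> : 'D_v (fun y => Num.sqrt (f y)) x =
    'D_1 (Num.sqrt \o (fun h : R => f (h *: v + x))) 0 by rewrite /derive E.
by rewrite D2 E2 /= scale0r add0r mulrC.
Qed.

Lemma Ck_sqrt k U f : open U -> (forall x, U x -> 0 < f x) ->
  Ck k U f -> Ck k U (fun x => Num.sqrt (f x)).
Proof.
move=> oU f0.
have C k' x : Ck k' U f -> U x -> {for x, continuous (fun x => Num.sqrt (f x))}.
  move=> hf Ux; apply: (@continuous_comp _ _ _ f Num.sqrt); first exact: Ck_continuous hf Ux.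
  exact: sqrt_continuous.
elim: k => [|k IH] hf; first by split=> // x Ux; exact: C hf Ux.
split=> [x Ux|]; first exact: C hf Ux.
have [cf [df pf]] := hf; split=> [i x Ux|i].
  by have [] := sqrt_is_derive (f0 x Ux) (df i x Ux).
have h := IH (Ck_pred hf).
have h2 : Ck k U (fun x => 2 * Num.sqrt (f x)) := Ck_mul oU (Ck_cst k U 2) h.
have h2' : forall x, U x -> 2 * Num.sqrt (f x) != 0.
  by move=> x Ux; rewrite mulf_neq0 ?pnatr_eq0// gt_eqF// sqrtr_gt0 f0.
apply: Ck_ext oU _ (Ck_mul oU (pf i) (Ck_inv oU h2' h2)) => x Ux.
by have [_ E] := sqrt_is_derive (f0 x Ux) (df i x Ux); rewrite /pd E.
Qed.

Lemma derive_comp_Ck m (f : 'rV[R]_m -> R) (V : set 'rV[R]_m)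
    (phi : 'rV[R]_n -> 'rV[R]_m) (oV : open V) x i : Ck 1 V f -> V (phi x) ->
  (forall j, derivable (fun y => phi y ord0 j) x (delta_mx ord0 i)) ->
  is_derive x (delta_mx ord0 i) (f \o phi)
    (\sum_j pd j f (phi x) * pd i (fun y => phi y ord0 j) x).
Proof.
move=> [_ [df pf]] Vx dphi; apply: derive_chain => [j|j|]; last exact: dphi.
  by apply: filterS (open_near oV Vx) => y; exact: df.
by have [c _] := pf j; exact: c.
Qed.

(** Induction on the order: by the chain rule a partial derivative of the composite is a sum of
    products of composites [pd j f] o phi, one order lower, with partial derivatives of phi. *)
Lemma Ck_comp k m (f : 'rV[R]_m -> R) (V : set 'rV[R]_m)
  (phi : 'rV[R]_n -> 'rV[R]_m) (U : set 'rV[R]_n) :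
  open V -> open U -> (forall x, U x -> V (phi x)) ->
  Ck k V f -> (forall j, Ck k U (fun x => phi x ord0 j)) ->
  Ck k U (fun x => f (phi x)).
Proof.
move=> oV oU UV.
have C k' (f' : 'rV[R]_m -> R) x : Ck k' V f' -> (forall j, Ck k' U (fun x => phi x ord0 j)) -> U x ->
   {for x, continuous (fun x => f' (phi x))}.
  move=> hf hphi Ux; apply: (@continuous_comp _ _ _ phi f').
    move=> P /nbhs_rVP[e e0 eP].
    have H (j : 'I_m) : \forall y \near x, `|phi y ord0 j - phi x ord0 j| < e.
      have := Ck_continuous (hphi j) Ux.
      move/(@cvgrPdist_lt _ _ _ (nbhs x) (nbhs_filter x))/(_ _ e0).
      by apply: filterS => y; rewrite distrC.
    have := filter_forall (nbhs_filter x) H.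
    apply: filterS => h hj; exact: eP.
  exact: Ck_continuous hf (UV _ Ux).
elim: k f => [|k IH] f hf hphi; first by split=> // x Ux; exact: C hf hphi Ux.
split=> [x Ux|]; first exact: C hf hphi Ux.
have D i x : U x -> is_derive x (delta_mx ord0 i) (f \o phi)
    (\sum_j pd j f (phi x) * pd i (fun y => phi y ord0 j) x).
  move=> Ux; apply: (derive_comp_Ck oV) (UV _ Ux) _.
    by move: hf; clear; elim: k => [//|k IH] /Ck_pred.
  by move=> j; have [_ [d _]] := hphi j; exact: d.
split=> [i x Ux|i]; first by have [] := D i x Ux.
have [cf [df pf]] := hf.
have P j : Ck k U (fun x => pd j f (phi x) * pd i (fun y => phi y ord0 j) x).
  apply: (Ck_mul oU); first by apply: IH => [|l]; [exact: pf|exact: Ck_pred (hphi l)].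
  by have [_ [_]] := hphi j; exact.
apply: Ck_ext oU _ (Ck_sum oU P) => x Ux.
by have [_ E] := D i x Ux; rewrite /pd [RHS]E.
Qed.

Section On.
Variable U : set 'rV[R]_n.
Hypothesis oU : open U.

Lemma smooth_cst (c : R) : smooth_on U (fun _ => c).
Proof. by apply/smooth_onP => k; exact: Ck_cst. Qed.

Lemma smooth_coord j : smooth_on U (fun x => x ord0 j).
Proof. by apply/smooth_onP => k; exact: Ck_coord. Qed.

Lemma smooth_add f g : smooth_on U f -> smooth_on U g -> smooth_on U (fun x => f x + g x).
Proof. by move=> /smooth_onP hf /smooth_onP hg; apply/smooth_onP => k; exact: Ck_add. Qed.

Lemma smooth_mul f g : smooth_on U f -> smooth_on U g -> smooth_on U (fun x => f x * g x).
Proof. by move=> /smooth_onP hf /smooth_onP hg; apply/smooth_onP => k; exact: Ck_mul. Qed.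

Lemma smooth_opp f : smooth_on U f -> smooth_on U (fun x => - f x).
Proof.
move=> hf; apply: smooth_ext oU _ (smooth_mul (smooth_cst (-1)) hf) => x _.
by rewrite mulN1r.
Qed.

Lemma smooth_sub f g : smooth_on U f -> smooth_on U g -> smooth_on U (fun x => f x - g x).
Proof. by move=> hf hg; exact: smooth_add hf (smooth_opp hg). Qed.

Lemma smooth_bigsum (I : Type) (r : seq I) (P : pred I) (F : I -> 'rV[R]_n -> R) :
  (forall i, smooth_on U (F i)) -> smooth_on U (fun x => \sum_(i <- r | P i) F i x).
Proof.
move=> hF; elim: r => [|i r IH].
  by apply: smooth_ext oU _ (smooth_cst 0) => x _; rewrite big_nil.
case Pi: (P i); last by apply: smooth_ext oU _ IH => x _; rewrite big_cons Pi.
by apply: smooth_ext oU _ (smooth_add (hF i) IH) => x _; rewrite big_cons Pi.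
Qed.

Lemma smooth_bigprod (I : Type) (r : seq I) (P : pred I) (F : I -> 'rV[R]_n -> R) :
  (forall i, smooth_on U (F i)) -> smooth_on U (fun x => \prod_(i <- r | P i) F i x).
Proof.
move=> hF; elim: r => [|i r IH].
  by apply: smooth_ext oU _ (smooth_cst 1) => x _; rewrite big_nil.
case Pi: (P i); last by apply: smooth_ext oU _ IH => x _; rewrite big_cons Pi.
by apply: smooth_ext oU _ (smooth_mul (hF i) IH) => x _; rewrite big_cons Pi.
Qed.

Lemma smooth_inv f : (forall x, U x -> f x != 0) -> smooth_on U f ->
  smooth_on U (fun x => (f x)^-1).
Proof. by move=> f0 /smooth_onP hf; apply/smooth_onP => k; exact: Ck_inv. Qed.

Lemma smooth_sqrt f : (forall x, U x -> 0 < f x) -> smooth_on U f ->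
  smooth_on U (fun x => Num.sqrt (f x)).
Proof. by move=> f0 /smooth_onP hf; apply/smooth_onP => k; exact: Ck_sqrt. Qed.

Lemma smooth_comp m (f : 'rV[R]_m -> R) (V : set 'rV[R]_m) (phi : 'rV[R]_n -> 'rV[R]_m) :
  open V -> (forall x, U x -> V (phi x)) -> smooth_on V f ->
  (forall j, smooth_on U (fun x => phi x ord0 j)) -> smooth_on U (fun x => f (phi x)).
Proof.
move=> oV UV /smooth_onP hf hphi; apply/smooth_onP => k.
by apply: Ck_comp oV oU UV (hf k) _ => j; apply: (smooth_onP _ _).1.
Qed.

Lemma pd_comp m (f : 'rV[R]_m -> R) (V : set 'rV[R]_m) (phi : 'rV[R]_n -> 'rV[R]_m) i x :
  open V -> V (phi x) -> smooth_on V f ->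
  (forall j, smooth_on U (fun x => phi x ord0 j)) -> U x ->
  pd i (fun x => f (phi x)) x = \sum_j pd j f (phi x) * pd i (fun y => phi y ord0 j) x.
Proof.
move=> oV Vx /smooth_onP hf hphi Ux.
have [//|_ E] := @derive_comp_Ck m f V phi oV x i (hf 1%N) Vx; last exact: E.
by move=> j; exact: smooth_derivable (hphi j) Ux.
Qed.

Variable x : 'rV[R]_n.
Hypothesis Ux : U x.

Lemma pdD i f g : smooth_on U f -> smooth_on U g ->
  pd i (fun y => f y + g y) x = pd i f x + pd i g x.
Proof. by move=> hf hg; rewrite /pd -deriveD //; exact: smooth_derivable Ux. Qed.

Lemma pdB i f g : smooth_on U f -> smooth_on U g ->
  pd i (fun y => f y - g y) x = pd i f x - pd i g x.
Proof. by move=> hf hg; rewrite /pd -deriveB //; exact: smooth_derivable Ux. Qed.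

Lemma pdN i f : smooth_on U f -> pd i (fun y => - f y) x = - pd i f x.
Proof. by move=> hf; rewrite /pd -deriveN //; exact: smooth_derivable Ux. Qed.

Lemma pdM i f g : smooth_on U f -> smooth_on U g ->
  pd i (fun y => f y * g y) x = pd i f x * g x + f x * pd i g x.
Proof.
move=> hf hg; rewrite addrC [_ * g x]mulrC -[RHS]deriveM //; exact: smooth_derivable Ux.
Qed.

Lemma pdZ i c f : smooth_on U f -> pd i (fun y => c * f y) x = c * pd i f x.
Proof. by move=> hf; rewrite (pdM i (smooth_cst c) hf) pd_cst mul0r add0r. Qed.

Lemma pd_sum i (I : Type) (r : seq I) (P : pred I) (F : I -> 'rV[R]_n -> R) :
  (forall j, smooth_on U (F j)) ->
  pd i (fun y => \sum_(j <- r | P j) F j y) x = \sum_(j <- r | P j) pd i (F j) x.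
Proof.
move=> hF; elim: r => [|j r IH].
  rewrite big_nil (_ : (fun _ => _) = fun=> 0) ?pd_cst//.
  by apply/funext => y; rewrite big_nil.
rewrite big_cons; case: ifP => Pj.
  rewrite -IH -pdD //; last exact: smooth_bigsum.
  by congr (pd _ _ _); apply/funext => y; rewrite big_cons Pj.
by rewrite -IH; congr (pd _ _ _); apply/funext => y; rewrite big_cons Pj.
Qed.

End On.
End SmoothClosure.

(** * One-parameter families of functions *)

Section Families.
Context {R : realType}.

Section Dim.
Context {n : nat}.
Implicit Types (f h : R -> 'rV[R]_n -> R) (D : set (R * 'rV[R]_n)) (x : 'rV[R]_n).

(** This is the function that [smooth_family_on] declares smooth; passing to it makes every rule for
    [pd] available for lambda and x alike. *)
Definition joint f (z : 'rV[R]_(1 + n)) : R := f (lsubmx z ord0 ord0) (rsubmx z).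

Definition joint_pt (la : R) x : 'rV[R]_(1 + n) := row_mx (const_mx la) x.

Definition joint_dom D : set 'rV[R]_(1 + n) :=
  [set z | D (lsubmx z ord0 ord0, rsubmx z)].

Definition dlambda f x : R := pd (lshift n ord0) (joint f) (joint_pt 0 x).

Lemma joint_ptE f la x : joint f (joint_pt la x) = f la x.
Proof. by rewrite /joint row_mxKl row_mxKr mxE. Qed.

Lemma joint_domE D la x : joint_dom D (joint_pt la x) = D (la, x).
Proof. by rewrite /joint_dom /= row_mxKl row_mxKr mxE. Qed.

Lemma joint_pt_surj z : z = joint_pt (lsubmx z ord0 ord0) (rsubmx z).
Proof.
rewrite -[LHS]hsubmxK; congr row_mx; apply/matrixP => i j.
by rewrite [RHS]mxE !ord1.
Qed.

Lemma joint_pt_lshift la x : joint_pt la x ord0 (lshift n ord0) = la.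
Proof. by rewrite /joint_pt row_mxEl mxE. Qed.

Lemma joint_pt_rshift la x j : joint_pt la x ord0 (rshift 1 j) = x ord0 j.
Proof. by rewrite /joint_pt row_mxEr. Qed.

Lemma joint_dom_open D : open D -> open (joint_dom D).
Proof.
move=> oD; rewrite openE => z Dz; rewrite /interior.
have := open_nbhs_nbhs (conj oD Dz).
case=> -[A B] [/= /nbhs_ballP[a a0 aA] /nbhs_rVP[b b0 bB]] AB.
apply/nbhs_rVP; exists (Num.min a b); first by rewrite lt_min a0 b0.
move=> y yz; apply: AB; split => /=.
  apply: aA; rewrite /ball /= !mxE distrC.
  by apply: lt_le_trans (yz _) _; rewrite ge_min lexx.
apply: bB => j; rewrite !mxE.
by apply: lt_le_trans (yz _) _; rewrite ge_min lexx orbT.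
Qed.

Lemma pd_rshift (i : 'I_n) f z :
  pd (rshift 1 i) (joint f) z = joint (fun la => pd i (f la)) z.
Proof.
rewrite /pd /joint /derive.
have -> // : (fun h : R => h^-1 *: (((fun z => f (lsubmx z ord0 ord0) (rsubmx z)) \o shift z)
     (h *: delta_mx ord0 (rshift 1 i)) - f (lsubmx z ord0 ord0) (rsubmx z))) =
  (fun h : R => h^-1 *: ((f (lsubmx z ord0 ord0) \o shift (rsubmx z))
     (h *: delta_mx ord0 i) - f (lsubmx z ord0 ord0) (rsubmx z))).
apply/funext => h /=; congr (_ *: (f _ _ - _)).
  by rewrite !mxE eqxx eq_lrshift mulr0 add0r.
apply/rowP => k; by rewrite !mxE !eqxx /= eq_rshift.
Qed.

Lemma pd_lshift_slice f (la : R) x :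
  pd (lshift n ord0) (joint f) (joint_pt la x) = 'D_1 (fun la => f la x) la.
Proof.
rewrite /pd /derive joint_ptE.
have -> // : (fun h : R => h^-1 *: ((joint f \o shift (joint_pt la x))
     (h *: delta_mx ord0 (lshift n ord0)) - f la x)) =
  (fun h : R => h^-1 *: (((fun la => f la x) \o shift la) (h *: 1) - f la x)).
apply/funext => h /=; congr (_ *: (_ - _)).
rewrite [h *: 1]mulr1 -[RHS]joint_ptE; congr (joint f _).
apply/rowP => k; case: (split_ordP k) => j ->.
  by rewrite [j]ord1 mxE [X in X + _]mxE delta_rVE !joint_pt_lshift eqxx mulr1.
by rewrite mxE [X in X + _]mxE delta_rVE !joint_pt_rshift eq_rlshift mulr0 add0r.
Qed.

Lemma pds_rshift (s : seq 'I_n) f z :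
  pds (map (@rshift 1 n) s) (joint f) z = joint (fun la => pds s (f la)) z.
Proof.
elim: s z => [//|i s IH] z /=; rewrite -pd_rshift; congr (pd _ _ z).
exact/funext.
Qed.

Lemma family_smooth D f : smooth_family_on D f -> smooth_on (joint_dom D) (joint f).
Proof. by []. Qed.

Lemma smooth_family_pds D f s : smooth_family_on D f ->
  smooth_family_on D (fun la => pds s (f la)).
Proof.
move=> sf; have := smooth_pds (map (@rshift 1 n) s) (family_smooth sf).
by rewrite (_ : pds _ _ = joint (fun la => pds s (f la))) //; apply/funext => z; exact: pds_rshift.
Qed.

Lemma smooth_family_pd D f i : smooth_family_on D f ->
  smooth_family_on D (fun la => pd i (f la)).
Proof. exact: (@smooth_family_pds D f [:: i]). Qed.

Lemma smooth_slice D f (U : set 'rV[R]_n) la : open D -> open U ->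
  (forall x, U x -> D (la, x)) -> smooth_family_on D f -> smooth_on U (f la).
Proof.
move=> oD oU UD sf.
have : smooth_on U (fun x => joint f (joint_pt la x)).
  apply: (smooth_comp oU (joint_dom_open oD) _ sf) => [x Ux|j].
    by rewrite joint_domE; exact: UD.
  case: (split_ordP j) => k ->.
    apply: smooth_ext oU _ (@smooth_cst R n U la) => x _.
    by rewrite [k]ord1 joint_pt_lshift.
  by apply: smooth_ext oU _ (@smooth_coord R n U k) => x _; rewrite joint_pt_rshift.
by apply: smooth_ext oU _ => x _; exact: joint_ptE.
Qed.

Lemma smooth_family_cst D (g : 'rV[R]_n -> R) (U : set 'rV[R]_n) :
  open D -> open U -> (forall z, D z -> U z.2) -> smooth_on U g ->
  smooth_family_on D (fun _ => g).
Proof.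
move=> oD oU DU sg.
apply: (smooth_comp (joint_dom_open oD) oU (phi := @rsubmx R 1 1 n) _ sg) => [z /DU //|j].
apply: smooth_ext (joint_dom_open oD) _ (@smooth_coord R _ _ (rshift 1 j)) => z _.
by rewrite mxE.
Qed.

Lemma smooth_family_ext D f h : open D -> (forall z, D z -> f z.1 z.2 = h z.1 z.2) ->
  smooth_family_on D f -> smooth_family_on D h.
Proof.
move=> oD fh; apply: smooth_ext (joint_dom_open oD) _ => z Dz.
exact: (fh (lsubmx z ord0 ord0, rsubmx z) Dz).
Qed.

(** Symmetry of second derivatives in the 1 + n joint variables. [joint_pt_surj] allows the
    lambda-derivative of [joint f] to be read as a family again, whose x-derivative is then taken
    slice by slice. *)
Lemma dlambda_pd D f i x : open D -> D (0, x) -> smooth_family_on D f ->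
  dlambda (fun la => pd i (f la)) x = pd i (dlambda f) x.
Proof.
move=> oD Dx sf.
have E1 : joint (fun la => pd i (f la)) = pd (rshift 1 i) (joint f).
  by apply/funext => z; rewrite pd_rshift.
have Dz : joint_dom D (joint_pt 0 x) by rewrite joint_domE.
have E2 := @pd_comm R (1 + n) (joint_dom D) (joint f) (lshift n ord0) (rshift 1 i)
  (joint_pt 0 x) (joint_dom_open oD) sf Dz.
pose g la y := pd (lshift n ord0) (joint f) (joint_pt la y).
have E3 : pd (lshift n ord0) (joint f) = joint g.
  by apply/funext => z; rewrite /g /joint -joint_pt_surj.
have -> : pd i (dlambda f) x = pd (rshift 1 i) (joint g) (joint_pt 0 x).
  exact: esym (etrans (pd_rshift i g (joint_pt 0 x)) (joint_ptE _ 0 x)).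
have E4 : dlambda (fun la => pd i (f la)) x =
    pd (lshift n ord0) (pd (rshift 1 i) (joint f)) (joint_pt 0 x).
  exact: (congr1 (fun F => pd (lshift n ord0) F (joint_pt 0 x)) E1).
have E5 : pd (rshift 1 i) (pd (lshift n ord0) (joint f)) (joint_pt 0 x) =
    pd (rshift 1 i) (joint g) (joint_pt 0 x).
  exact: (congr1 (fun F => pd (rshift 1 i) F (joint_pt 0 x)) E3).
apply: etrans E4 _.
apply: etrans E2 _.
exact: E5.
Qed.

Lemma dlambda_cst (g : 'rV[R]_n -> R) x : dlambda (fun _ => g) x = 0.
Proof. by rewrite /dlambda pd_lshift_slice derive_cst. Qed.

End Dim.
End Families.

(** * First-order expansion in lambda *)

Section Jets.
Context {R : realType} {n : nat}.
Implicit Types (f h : R -> 'rV[R]_n -> R) (D : set (R * 'rV[R]_n)) (x : 'rV[R]_n).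

Lemma joint_pt_shift (la s : R) x :
  joint_pt la x + s *: delta_mx ord0 (lshift n ord0) = joint_pt (la + s) x.
Proof.
apply/rowP => k; case: (split_ordP k) => j ->.
  by rewrite [j]ord1 mxE [X in _ + X]mxE delta_rVE !joint_pt_lshift eqxx mulr1.
by rewrite mxE [X in _ + X]mxE delta_rVE !joint_pt_rshift eq_rlshift mulr0 addr0.
Qed.

(** Two mean value steps in lambda, from 0 to [la] and from 0 to the intermediate s, leave [la * s]
    times a second lambda-derivative with |s| at most |la|. Continuity of that derivative bounds it
    uniformly for y near x. *)
Lemma family_taylor D f x : open D -> D (0, x) -> smooth_family_on D f ->
  (forall y, D (0, y) -> f 0 y = 0 /\ dlambda f y = 0) ->
  exists C : R, \forall z \near ((0 : R), x), `|f z.1 z.2| <= C * z.1 ^+ 2.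
Proof.
move=> oD Dx sf f0.
have oJ := joint_dom_open oD.
have Jx : joint_dom D (joint_pt 0 x) by rewrite joint_domE.
pose l : 'I_(1 + n) := lshift n ord0; pose F := joint f; pose F2 := pd l (pd l F).
have sF1 : smooth_on (joint_dom D) (pd l F) := smooth_pd l sf.
have sF2 : smooth_on (joint_dom D) F2 := smooth_pd l sF1.
have nF2 : \forall z \near joint_pt 0 x, `|F2 (joint_pt 0 x) - F2 z| < 1.
  have := smooth_continuous sF2 Jx.
  by move/(@cvgrPdist_lt _ _ _ (nbhs (joint_pt 0 x)) (nbhs_filter _))/(_ _ ltr01).
have : \forall z \near joint_pt 0 x, joint_dom D z /\ `|F2 (joint_pt 0 x) - F2 z| < 1.
  exact: filterI (open_near oJ Jx) nF2.
move=> /nbhs_rVP[r r0 rP].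
(* On the box [F2] differs by less than 1 from its value at (0, x). *)
pose C := `|F2 (joint_pt 0 x)| + 1.
have box (s : R) (y : 'rV[R]_n) : `|s| < r -> (forall j, `|y ord0 j - x ord0 j| < r) ->
    joint_dom D (joint_pt s y) /\ `|F2 (joint_pt s y)| <= C.
  move=> sr yr; have [|Dz dz] := rP (joint_pt s y).
    move=> k; case: (split_ordP k) => j ->.
      by rewrite [j]ord1 !joint_pt_lshift subr0.
    by rewrite !joint_pt_rshift; exact: yr.
  split; first exact: Dz.
  rewrite -[X in `|X|](subKr (F2 (joint_pt 0 x))).
  by apply: le_trans (ler_normB _ _) _; rewrite lerD2l ltW.
exists C; exists ([set la : R | `|la| < r], [set y : 'rV[R]_n | forall j, `|y ord0 j - x ord0 j| < r]).
  split => /=; last by apply/nbhs_rVP; exists r.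
  by apply/nbhs_ballP; exists r => // la; rewrite /ball /= sub0r normrN.
move=> [la y] [/= lar yr].
have Dy : D (0, y) by rewrite -joint_domE; apply: (box 0 y _ yr).1; rewrite normr0.
have [fy dfy] := f0 y Dy.
have [|s sl E] := @line_mvt R (1 + n) F (joint_pt 0 y) (delta_mx ord0 l) la.
  move=> s sl; rewrite joint_pt_shift add0r; apply: smooth_derivable sf _.
  exact: (box s y (le_lt_trans sl lar) yr).1.
have [|s' sl' E'] := @line_mvt R (1 + n) (pd l F) (joint_pt 0 y) (delta_mx ord0 l) s.
  move=> s' sl'; rewrite joint_pt_shift add0r; apply: smooth_derivable sF1 _.
  exact: (box s' y (le_lt_trans sl' (le_lt_trans sl lar)) yr).1.
move: E E'; rewrite !joint_pt_shift !add0r /F !joint_ptE fy subr0 => -> E'.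
have -> : 'D_(delta_mx ord0 l) (joint f) (joint_pt s y) = s * F2 (joint_pt s' y).
  by rewrite -[RHS]E' -[pd l _ (joint_pt 0 y)]/(dlambda f y) dfy subr0.
rewrite !normrM mulrA mulrC; apply: ler_pM => //.
- exact: (box s' y (le_lt_trans sl' (le_lt_trans sl lar)) yr).2.
- by rewrite -[la ^+ 2]ger0_norm ?sqr_ge0// normrX expr2 ler_wpM2l.
Qed.

Lemma pds_const0 (U : set 'rV[R]_n) (g : 'rV[R]_n -> R) s x :
  open U -> (forall y, U y -> g y = 0) -> U x -> pds s g x = 0.
Proof.
move=> oU g0 Ux; rewrite (pds_ext s oU g0 Ux).
elim: s x Ux => [//|i s IH] x Ux /=.
by rewrite (pd_ext i oU Ux IH) pd_cst.
Qed.

Lemma dlambda_pds D f s (U : set 'rV[R]_n) x : open D -> open U -> (forall x, U x -> D (0, x)) ->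
  smooth_family_on D f -> U x ->
  dlambda (fun la => pds s (f la)) x = pds s (dlambda f) x.
Proof.
move=> oD oU UD sf; elim: s x => [//|i s IH] x Ux /=.
rewrite (dlambda_pd i oD (UD x Ux) (smooth_family_pds s sf)).
exact: pd_ext oU Ux IH.
Qed.

(** Differentiation in x preserves the vanishing of the value and of the lambda-derivative at 0, so
    [family_taylor] applies to each [pds s] of the family. *)
Lemma Olambda2_intro D f (U : set 'rV[R]_n) : open D -> open U ->
  (forall x, U x -> D (0, x)) -> smooth_family_on D f ->
  (forall x, U x -> f 0 x = 0) -> (forall x, U x -> dlambda f x = 0) ->
  Olambda2 U f.
Proof.
move=> oD oU UD sf f0 f1 s x Ux.
(* [family_taylor] asks for vanishing at all points (0, y) of its domain, whereas it is known only
   for y in U. *)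
pose D' := [set z | D z /\ U z.2] : set (R * 'rV[R]_n).
have oD' : open D'.
  by apply: openI => //; apply: open_comp oU => z _; exact: cvg_snd.
have sf' : smooth_family_on D' (fun la => pds s (f la)).
  by apply: smooth_subset (smooth_family_pds s sf) => z [].
apply: (family_taylor oD' _ sf'); first by split => //; exact: UD.
move=> y [Dy Uy]; split; first exact: (pds_const0 s oU f0 Uy).
rewrite (dlambda_pds s oD oU UD sf Uy).
exact: (pds_const0 s oU f1 Uy).
Qed.

(** The bound at lambda = 0 forces the value to vanish; then the difference quotient is at most a
    multiple of |lambda| and tends to 0. *)
Lemma Olambda2_jet f (U : set 'rV[R]_n) x : Olambda2 U f -> U x ->
  f 0 x = 0 /\ dlambda f x = 0.
Proof.
move=> Of Ux; have [C /= nC] := Of [::] x Ux.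
have f0 : f 0 x = 0.
  have /= := nbhs_singleton nC; rewrite expr0n /= mulr0 normr_le0.
  by move/eqP.
split=> //.
have nla : \forall la \near (0 : R), `|f la x| <= C * la ^+ 2.
  case: nC => -[A B] [/= A0 Bx] AB.
  apply: filterS A0 => la Ala; apply: (AB (la, x)); split=> //=.
  exact: nbhs_singleton Bx.
rewrite /dlambda pd_lshift_slice /derive.
have E : (fun h : R => h^-1 *: (((fun la => f la x) \o shift 0) (h *: 1) - f 0 x)) =
   fun h : R => h^-1 * f h x.
  by apply/funext => h /=; rewrite f0 subr0 addr0 [h *: 1]mulr1.
rewrite E; apply/cvg_lim => //.
apply/cvgr0Pnorm_lt => e e0.
(* The constant C may be zero or negative; [|C| + 1] is a bound that can be divided by. *)
have C1 : 0 < `|C| + 1 by rewrite ltr_wpDl.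
have nd : \forall la \near (0:R)^', `|f la x| <= C * la ^+ 2.
  by apply: nbhs_dnbhs.
have ne : \forall la \near (0:R)^', `|la| < e / (`|C| + 1).
  by apply: dnbhs0_lt; rewrite divr_gt0.
near=> h.
have h0 : h != 0 by near: h; exact: nbhs_dnbhs_neq.
have hn : 0 < `|h| by rewrite normr_gt0.
rewrite normrM normfV mulrC ltr_pdivrMr //.
apply: (@le_lt_trans _ _ (C * h ^+ 2)); first by near: h.
have he : `|h| < e / (`|C| + 1) by near: h.
rewrite -[h ^+ 2]ger0_norm ?sqr_ge0// normrX expr2 mulrA ltr_pM2r//.
apply: (@le_lt_trans _ _ (`|C| * `|h|)); first by rewrite ler_wpM2r// ler_norm.
move: he; rewrite ltr_pdivlMr// mulrC; apply: le_lt_trans.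
by rewrite ler_wpM2r// lerDl.
Unshelve. all: by end_near. Qed.

Lemma Olambda2_ext f h (U : set 'rV[R]_n) : open U ->
  (forall la x, U x -> f la x = h la x) -> Olambda2 U f -> Olambda2 U h.
Proof.
move=> oU fh Of s x Ux; have [C nC] := Of s x Ux; exists C.
have nU : \forall z \near ((0 : R), x), U z.2.
  by apply: (cvg_snd (F := nbhs (0 : R)) (G := nbhs x)); exact: open_near.
apply: filterS2 nC nU => z + Uz.
by rewrite (pds_ext s oU (fh z.1) Uz).
Qed.

Section Rules.
Variables (D : set (R * 'rV[R]_n)).
Hypothesis oD : open D.
Let oJ := joint_dom_open oD.

Lemma smooth_family_const (c : R) : smooth_family_on D (fun _ _ => c).
Proof. exact: smooth_cst. Qed.

Lemma smooth_family_add f h : smooth_family_on D f -> smooth_family_on D h ->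
  smooth_family_on D (fun la x => f la x + h la x).
Proof. exact: smooth_add. Qed.

Lemma smooth_family_sub f h : smooth_family_on D f -> smooth_family_on D h ->
  smooth_family_on D (fun la x => f la x - h la x).
Proof. exact: smooth_sub. Qed.

Lemma smooth_family_mul f h : smooth_family_on D f -> smooth_family_on D h ->
  smooth_family_on D (fun la x => f la x * h la x).
Proof. exact: smooth_mul. Qed.

Lemma smooth_family_bigsum (I : Type) (r : seq I) (P : pred I)
    (F : I -> R -> 'rV[R]_n -> R) :
  (forall i, smooth_family_on D (F i)) ->
  smooth_family_on D (fun la x => \sum_(i <- r | P i) F i la x).
Proof. by move=> hF; exact: (smooth_bigsum oJ r P hF). Qed.

Variable x : 'rV[R]_n.
Hypothesis Dx : D (0, x).
Let Jx : joint_dom D (joint_pt 0 x).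
Proof. by rewrite joint_domE. Qed.

Lemma dlambdaD f h : smooth_family_on D f -> smooth_family_on D h ->
  dlambda (fun la x => f la x + h la x) x = dlambda f x + dlambda h x.
Proof. by move=> sf sh; exact: (pdD Jx (lshift n ord0) sf sh). Qed.

Lemma dlambdaB f h : smooth_family_on D f -> smooth_family_on D h ->
  dlambda (fun la x => f la x - h la x) x = dlambda f x - dlambda h x.
Proof. by move=> sf sh; exact: (pdB Jx (lshift n ord0) sf sh). Qed.

Lemma dlambdaM f h : smooth_family_on D f -> smooth_family_on D h ->
  dlambda (fun la x => f la x * h la x) x = dlambda f x * h 0 x + f 0 x * dlambda h x.
Proof.
move=> sf sh; have := pdM Jx (lshift n ord0) sf sh.
by rewrite -!/(joint _) -!/(joint _ _) !joint_ptE.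
Qed.

Lemma dlambda_sum (I : Type) (r : seq I) (P : pred I)
    (F : I -> R -> 'rV[R]_n -> R) :
  (forall i, smooth_family_on D (F i)) ->
  dlambda (fun la x => \sum_(i <- r | P i) F i la x) x =
  \sum_(i <- r | P i) dlambda (F i) x.
Proof. by move=> hF; exact: (pd_sum oJ Jx (lshift n ord0) r P hF). Qed.

End Rules.

Section CompRules.
Variables (m : nat) (D : set (R * 'rV[R]_n)) (E : set (R * 'rV[R]_m)).
Variables (h : R -> 'rV[R]_m -> R) (u : R -> 'rV[R]_n -> 'rV[R]_m).
Hypotheses (oD : open D) (oE : open E) (sh : smooth_family_on E h).
Hypothesis su : forall k, smooth_family_on D (fun la x => u la x ord0 k).

(** The map (lambda, x) -> (lambda, u_lambda(x)) turns a composition of families into an ordinary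
    composition of functions. *)
Let phi (z : 'rV[R]_(1 + n)) : 'rV[R]_(1 + m) :=
  joint_pt (lsubmx z ord0 ord0) (u (lsubmx z ord0 ord0) (rsubmx z)).

Let phi_lshift : (fun z => phi z ord0 (lshift m ord0)) = fun z => z ord0 (lshift n ord0).
Proof. by apply/funext => z; rewrite /phi joint_pt_lshift mxE. Qed.

Let phi_rshift k : (fun z => phi z ord0 (rshift 1 k)) = joint (fun la x => u la x ord0 k).
Proof. by apply/funext => z; rewrite /phi joint_pt_rshift. Qed.

Let sphi j : smooth_on (joint_dom D) (fun z => phi z ord0 j).
Proof.
case: (split_ordP j) => k ->; last by rewrite phi_rshift; exact: su.
by rewrite [k]ord1 phi_lshift; exact: smooth_coord.
Qed.

Lemma smooth_family_comp : (forall z, D z -> E (z.1, u z.1 z.2)) ->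
  smooth_family_on D (fun la x => h la (u la x)).
Proof.
move=> DE.
have : smooth_on (joint_dom D) (fun z => joint h (phi z)).
  apply: (smooth_comp (joint_dom_open oD) (joint_dom_open oE) _ sh sphi) => z Dz.
  by rewrite /phi joint_domE; exact: DE (_, _) Dz.
by apply: smooth_ext (joint_dom_open oD) _ => z _; rewrite /phi joint_ptE.
Qed.

(** Chain rule for [phi]: its lambda-coordinate has lambda-derivative 1 and yields the explicit
    dependence of h on lambda, the other coordinates yield the dependence through u. *)
Lemma dlambda_comp x : D (0, x) -> E (0, u 0 x) ->
  dlambda (fun la x => h la (u la x)) x =
  dlambda h (u 0 x) + \sum_k pd k (h 0) (u 0 x) * dlambda (fun la x => u la x ord0 k) x.
Proof.
move=> Dx Ex.
have phix : phi (joint_pt 0 x) = joint_pt 0 (u 0 x).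
  by rewrite /phi /joint_pt !row_mxKl !row_mxKr mxE.
have Jx : joint_dom D (joint_pt 0 x) by rewrite joint_domE.
have Jp : joint_dom E (phi (joint_pt 0 x)) by rewrite phix joint_domE.
have P := pd_comp (lshift n ord0) (joint_dom_open oE) Jp sh sphi Jx.
have Q : (fun z => joint h (phi z)) = joint (fun la x => h la (u la x)).
  by apply/funext => z; rewrite /phi joint_ptE.
have {}P : dlambda (fun la x => h la (u la x)) x =
  \sum_j pd j (joint h) (phi (joint_pt 0 x)) *
     pd (lshift n ord0) (fun z => phi z ord0 j) (joint_pt 0 x).
  by rewrite -P /dlambda -Q.
rewrite P big_split_ord big_ord1 /= phix phi_lshift pd_coord eqxx mulr1.
congr (_ + _); apply: eq_bigr => k _.
by rewrite phi_rshift pd_rshift joint_ptE.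
Qed.

End CompRules.
End Jets.

(** * The Levi-Civita symbol and the Hodge dual *)

Section LeviCivita.

Definition i0 : 'I_4 := @Ordinal 4 0 isT.
Definition i1 : 'I_4 := @Ordinal 4 1 isT.
Definition i2 : 'I_4 := @Ordinal 4 2 isT.
Definition i3 : 'I_4 := @Ordinal 4 3 isT.

Lemma ord4P (P : 'I_4 -> Prop) : P i0 -> P i1 -> P i2 -> P i3 -> forall a, P a.
Proof.
move=> P0 P1 P2 P3 [[|[|[|[|//]]]] H].
- by rewrite (_ : Ordinal _ = i0) //; exact: val_inj.
- by rewrite (_ : Ordinal _ = i1) //; exact: val_inj.
- by rewrite (_ : Ordinal _ = i2) //; exact: val_inj.
- by rewrite (_ : Ordinal _ = i3) //; exact: val_inj.
Qed.

Lemma sum4 (R : nmodType) (F : 'I_4 -> R) : \sum_i F i = F i0 + F i1 + F i2 + F i3.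
Proof.
rewrite !big_ord_recl big_ord0 addr0 !addrA.
by do ![congr (_ + _)]; congr F; exact: val_inj.
Qed.

Section Det.
Variable (R : comPzRingType).

(** With entries given by a function on natural numbers, a minor has the same shape as the original
    determinant, so the expansion can be iterated down to size 0. *)
Lemma det_rec n (m : nat -> nat -> R) :
  \det (\matrix_(i < n.+1, j < n.+1) m (val i) (val j)) =
  \sum_(j < n.+1) m 0%N (val j) * ((-1) ^+ val j *
    \det (\matrix_(a < n, b < n) m (val a).+1 (bump (val j) (val b)))).
Proof.
rewrite (expand_det_row _ ord0); apply: eq_bigr => j _.
rewrite /cofactor add0n !mxE; congr (_ * (_ * \det _)).
by apply/matrixP => a b; rewrite !mxE.
Qed.

Lemma det4 (m : nat -> nat -> R) :
  \det (\matrix_(i < 4, j < 4) m (val i) (val j)) =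
    m 0 0 * (m 1 1 * (m 2 2 * m 3 3 - m 2 3 * m 3 2)
             - m 1 2 * (m 2 1 * m 3 3 - m 2 3 * m 3 1)
             + m 1 3 * (m 2 1 * m 3 2 - m 2 2 * m 3 1))
  - m 0 1 * (m 1 0 * (m 2 2 * m 3 3 - m 2 3 * m 3 2)
             - m 1 2 * (m 2 0 * m 3 3 - m 2 3 * m 3 0)
             + m 1 3 * (m 2 0 * m 3 2 - m 2 2 * m 3 0))
  + m 0 2 * (m 1 0 * (m 2 1 * m 3 3 - m 2 3 * m 3 1)
             - m 1 1 * (m 2 0 * m 3 3 - m 2 3 * m 3 0)
             + m 1 3 * (m 2 0 * m 3 1 - m 2 1 * m 3 0))
  - m 0 3 * (m 1 0 * (m 2 1 * m 3 2 - m 2 2 * m 3 1)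
             - m 1 1 * (m 2 0 * m 3 2 - m 2 2 * m 3 0)
             + m 1 2 * (m 2 0 * m 3 1 - m 2 1 * m 3 0)).
Proof.
rewrite (det_rec _ m) !big_ord_recl big_ord0 /=.
rewrite !(det_rec _ (fun a b => m a.+1 (bump _ b))) !big_ord_recl !big_ord0 /=.
rewrite !(det_rec _ (fun a b => m a.+2 (bump _ (bump _ b)))) !big_ord_recl !big_ord0 /=.
rewrite !(det_rec _ (fun a b => m a.+3 (bump _ (bump _ (bump _ b))))) !big_ord_recl !big_ord0 /=.
rewrite !det_mx00 /bump /=.
ring.
Qed.
End Det.

(** The Levi-Civita symbol through the parity of the number of inversions; the six comparisons run
    over all pairs of positions. *)
Definition sgn4 (a b c d : nat) : int :=
  if uniq [:: a; b; c; d] then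
    if ((b < a) (+) (c < a) (+) (d < a) (+) (c < b) (+) (d < b) (+) (d < c))%N then -1 else 1
  else 0.

Section Eps.
Variable R : comPzRingType.

Definition eps4 (a b c d : 'I_4) : R :=
  \det (\matrix_(i < 4, j < 4) (tnth [tuple a; b; c; d] i == j)%:R).

Lemma eps4E a b c d : eps4 a b c d = (sgn4 a b c d)%:~R.
Proof.
(* Over the integers both sides can be evaluated, which settles the 256 index combinations by
   computation. *)
have -> : eps4 a b c d = (\det (\matrix_(i < 4, j < 4)
    ((nth 0%N [:: val a; val b; val c; val d] (val i) == val j)%:R : int)))%:~R.
  rewrite -[RHS](det_map_mx (intr : {rmorphism int -> R})); congr (\det _).
  apply/matrixP => i j; rewrite !mxE (tnth_nth i0); move: i.
  by apply: ord4P; rewrite /= -val_eqE; case: (_ == _).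
rewrite (det4 (fun i j => ((nth 0%N [:: val a; val b; val c; val d] i == j)%:R : int))).
congr intr.
move: d; apply: ord4P; move: c; apply: ord4P; move: b; apply: ord4P; move: a;
  by apply: ord4P; vm_compute.
Qed.

Lemma eps4_if a b c d : eps4 a b c d =
  if uniq [:: val a; val b; val c; val d] then
    if ((val b < val a) (+) (val c < val a) (+) (val d < val a) (+) (val c < val b)
        (+) (val d < val b) (+) (val d < val c))%N then -1 else 1
  else 0.
Proof. by rewrite eps4E /sgn4; case: ifP => // _; case: ifP. Qed.
End Eps.

End LeviCivita.

(** * The Hodge dual of a 2-form at a single point *)

Section Star.
Variable R : realFieldType.
Implicit Types (F G : 'I_4 -> 'I_4 -> R) (h : 'M[R]_4) (s : R).

Definition raise4 h F c d := \sum_e \sum_f h c e * h d f * F e f.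

(** Here h stands for the inverse metric and s for the square root of |det g| at one point, so that
    the identities for the dual become polynomial. *)
Definition star4 s h F a b :=
  2^-1 * \sum_c \sum_d raise4 h F c d * (s * eps4 R c d a b).

(** Half the contraction of an antisymmetric G with the Levi-Civita symbol, tabulated: up to sign,
    each entry is that of the complementary pair of indices. *)
Definition dual_table G (a b : 'I_4) : R :=
  match val a, val b with
  | 0%N, 1%N => G i2 i3 | 0%N, 2%N => - G i1 i3 | 0%N, 3%N => G i1 i2
  | 1%N, 2%N => G i0 i3 | 1%N, 3%N => - G i0 i2 | 2%N, 3%N => G i0 i1
  | 1%N, 0%N => - G i2 i3 | 2%N, 0%N => G i1 i3 | 3%N, 0%N => - G i1 i2
  | 2%N, 1%N => - G i0 i3 | 3%N, 1%N => G i0 i2 | 3%N, 2%N => - G i0 i1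
  | _, _ => 0
  end.

Lemma eps_contract G s a b : (forall c d, G c d = - G d c) ->
  2^-1 * (\sum_c \sum_d G c d * (s * eps4 R c d a b)) = s * dual_table G a b.
Proof.
move=> A.
have [[A10 A20] A30] := (A i1 i0, A i2 i0, A i3 i0).
have [[A21 A31] A32] := (A i2 i1, A i3 i1, A i3 i2).
rewrite !sum4 !eps4_if A10 A20 A30 A21 A31 A32 {A A10 A20 A30 A21 A31 A32}.
move: b; apply: ord4P; move: a; apply: ord4P;
  by rewrite /dual_table /=; field.
Qed.

Lemma raise4_anti h F c d : (forall a b, F a b = - F b a) ->
  raise4 h F c d = - raise4 h F d c.
Proof.
move=> A; rewrite /raise4 exchange_big /= -sumrN; apply: eq_bigr => f _.
by rewrite -sumrN; apply: eq_bigr => e _; rewrite A; ring.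
Qed.

Lemma dual_table_anti G a b : dual_table G a b = - dual_table G b a.
Proof. by move: b; apply: ord4P; move: a; apply: ord4P; rewrite /dual_table /= ?opprK ?oppr0. Qed.

Lemma det4_ord h : \det h =
    h i0 i0 * (h i1 i1 * (h i2 i2 * h i3 i3 - h i2 i3 * h i3 i2)
             - h i1 i2 * (h i2 i1 * h i3 i3 - h i2 i3 * h i3 i1)
             + h i1 i3 * (h i2 i1 * h i3 i2 - h i2 i2 * h i3 i1))
  - h i0 i1 * (h i1 i0 * (h i2 i2 * h i3 i3 - h i2 i3 * h i3 i2)
             - h i1 i2 * (h i2 i0 * h i3 i3 - h i2 i3 * h i3 i0)
             + h i1 i3 * (h i2 i0 * h i3 i2 - h i2 i2 * h i3 i0))
  + h i0 i2 * (h i1 i0 * (h i2 i1 * h i3 i3 - h i2 i3 * h i3 i1)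
             - h i1 i1 * (h i2 i0 * h i3 i3 - h i2 i3 * h i3 i0)
             + h i1 i3 * (h i2 i0 * h i3 i1 - h i2 i1 * h i3 i0))
  - h i0 i3 * (h i1 i0 * (h i2 i1 * h i3 i2 - h i2 i2 * h i3 i1)
             - h i1 i1 * (h i2 i0 * h i3 i2 - h i2 i2 * h i3 i0)
             + h i1 i2 * (h i2 i0 * h i3 i1 - h i2 i1 * h i3 i0)).
Proof.
pose o k := nth i0 [:: i0; i1; i2; i3] k.
rewrite -(det4 (fun i j => h (o i) (o j))); congr (\det _).
by apply/matrixP => i j; rewrite mxE; congr (h _ _); apply: val_inj; move: i j;
  do 2!(try apply: ord4P => //).
Qed.

(** On antisymmetric F, [raise4 h] acts by the 2 x 2 minors of h and [dual_table] passes to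
    complementary pairs, so this is the Laplace expansion of [\det h] along two rows. The six
    entries above the diagonal are checked as polynomial identities; antisymmetry gives the rest. *)
Lemma dual_raise_twice h F a b : h^T = h -> (forall a b, F a b = - F b a) ->
  dual_table (raise4 h (dual_table (raise4 h F))) a b = \det h * F a b.
Proof.
move=> hT A.
have S i j : h i j = h j i by rewrite -{1}hT mxE.
have D i : F i i = 0 by have := A i i; lra.
have [[A10 A20] A30] := (A i1 i0, A i2 i0, A i3 i0).
have [[A21 A31] A32] := (A i2 i1, A i3 i1, A i3 i2).
have [[S10 S20] S30] := (S i1 i0, S i2 i0, S i3 i0).
have [[S21 S31] S32] := (S i2 i1, S i3 i1, S i3 i2).
pose X := dual_table (raise4 h (dual_table (raise4 h F))).
have X_upper : forall a b : 'I_4, (a < b)%N -> X a b = \det h * F a b.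
  rewrite det4_ord S10 S20 S30 S21 S31 S32 /X.
  apply: ord4P; apply: ord4P => //= _; rewrite /dual_table /= /raise4 !sum4 /=;
    rewrite ?D ?A10 ?A20 ?A30 ?A21 ?A31 ?A32 ?S10 ?S20 ?S30 ?S21 ?S31 ?S32; ring.
rewrite -/X; case: (ltngtP a b) => [ab|ba|ab].
- exact: X_upper.
- by rewrite /X dual_table_anti -/X A mulrN X_upper.
- by rewrite (ord_inj ab) D mulr0 /X; move: b {ab}; apply: ord4P.
Qed.

(** The hypothesis on s and h carries the Lorentzian signature: s^2 = |det g| = - det g, and det h
    is the inverse of det g. *)
Lemma star4_involution s h F a b : h^T = h -> s ^+ 2 * \det h = -1 ->
  (forall a b, F a b = - F b a) -> star4 s h (star4 s h F) a b = - F a b.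
Proof.
move=> hT sd A.
have E F' c d : (forall a b, F' a b = - F' b a) ->
    star4 s h F' c d = s * dual_table (raise4 h F') c d.
  by move=> A'; apply: eps_contract => a' b'; exact: raise4_anti.
rewrite E; last first.
  by move=> a' b'; rewrite !E // dual_table_anti mulrN.
have -> : raise4 h (star4 s h F) = fun c d => s * raise4 h (dual_table (raise4 h F)) c d.
  apply/funext => c; apply/funext => d; rewrite /raise4 mulr_sumr.
  apply: eq_bigr => e _; rewrite mulr_sumr; apply: eq_bigr => f _.
  by rewrite E //; ring.
have -> : forall G c d, dual_table (fun c d => s * G c d) c d = s * dual_table G c d.
  move=> G c; apply: ord4P; move: c; apply: ord4P; rewrite /dual_table /=; ring.
by rewrite dual_raise_twice // mulrA -expr2 mulrA sd mulN1r.
Qed.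
End Star.

(** * Metrics and Killing fields *)

Section MatrixFields.
Context {R : realType} {n : nat}.
Variable U : set 'rV[R]_n.
Hypothesis oU : open U.

Lemma smooth_det m (A : 'rV[R]_n -> 'M[R]_m) :
  (forall i j, smooth_on U (fun x => A x i j)) -> smooth_on U (fun x => \det (A x)).
Proof.
move=> sA; apply: (smooth_bigsum oU) => s; apply: (smooth_mul oU).
  exact: smooth_cst.
by apply: (smooth_bigprod oU) => i; exact: sA.
Qed.

Lemma smooth_invmx m (A : 'rV[R]_n -> 'M[R]_m) i j :
  (forall i j, smooth_on U (fun x => A x i j)) -> (forall x, U x -> A x \in unitmx) ->
  smooth_on U (fun x => invmx (A x) i j).
Proof.
move=> sA uA.
have s1 : smooth_on U (fun x => (\det (A x))^-1 * cofactor (A x) j i).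
  apply: (smooth_mul oU).
    apply: (smooth_inv oU) (smooth_det sA) => x /uA; rewrite unitmxE unitfE.
    exact.
  apply: (smooth_mul oU); first exact: smooth_cst.
  apply: smooth_det => k l.
  by apply: smooth_ext oU _ (sA (lift j k) (lift i l)) => x _; rewrite !mxE.
by apply: smooth_ext oU _ s1 => x /uA uAx; rewrite /invmx uAx !mxE.
Qed.

Lemma pd_prod (I : eqType) (r : seq I) (f : I -> 'rV[R]_n -> R) c x : uniq r ->
  (forall i, smooth_on U (f i)) -> U x ->
  pd c (fun y => \prod_(k <- r) f k y) x =
  \sum_(i <- r) \prod_(k <- r) (if k == i then pd c (f k) x else f k x).
Proof.
move=> + sf Ux; elim: r => [|j r IH] /=.
  move=> _; rewrite big_nil (_ : (fun _ => _) = fun=> 1) ?pd_cst //.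
  by apply/funext => y; rewrite big_nil.
move=> /andP[jr ur].
have -> : (fun y => \prod_(k <- j :: r) f k y) = (fun y => f j y * \prod_(k <- r) f k y).
  by apply/funext => y; rewrite big_cons.
rewrite (pdM Ux c (sf j) (smooth_bigprod oU r xpredT sf)) IH //.
rewrite [in RHS]big_cons big_cons eqxx; congr (_ * _ + _).
  rewrite big_seq [RHS]big_seq; apply: eq_bigr => k kr; rewrite ifN //.
  by apply: contraNneq jr => <-.
rewrite big_distrr /= big_seq [RHS]big_seq; apply: eq_bigr => i ir.
rewrite big_cons ifN //.
by apply: contraNneq jr => ->.
Qed.

(** Jacobi's formula. The Leibniz sum is differentiated row by row; [B i] is A with row i
    differentiated, and its expansion along that row has the cofactors of A. *)
Lemma pd_det m (A : 'rV[R]_n -> 'M[R]_m) c x :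
  (forall i j, smooth_on U (fun x => A x i j)) -> U x ->
  pd c (fun y => \det (A y)) x =
  \sum_i \sum_j pd c (fun y => A y i j) x * cofactor (A x) i j.
Proof.
move=> sA Ux.
have sp s : smooth_on U (fun y => \prod_i A y i ((s : 'S_m) i)).
  by apply: (smooth_bigprod oU) => i; exact: sA.
rewrite /determinant (pd_sum oU Ux); last first.
  by move=> s; apply: (smooth_mul oU); [exact: smooth_cst|exact: sp].
pose B i : 'M[R]_m := \matrix_(k, l) (if k == i then pd c (fun y => A y k l) x else A x k l).
transitivity (\sum_i \det (B i)).
  rewrite /determinant exchange_big /=; apply: eq_bigr => s _.
  rewrite (pdZ Ux c _ (sp s)) (pd_prod c (index_enum_uniq _) (fun i => sA i (s i)) Ux).
  rewrite big_distrr /=; apply: eq_bigr => i _; congr (_ * _).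
  by apply: eq_bigr => k _; rewrite mxE.
apply: eq_bigr => i _; rewrite (expand_det_row _ i); apply: eq_bigr => j _.
rewrite mxE eqxx; congr (_ * (_ * \det _)).
by apply/matrixP => k l; rewrite !mxE eq_sym (negbTE (neq_lift _ _)).
Qed.

End MatrixFields.

(** * Christoffel symbols and compatibility with the metric *)

Section Metric.
Context {R : realType} {n : nat}.
Variables (U : set 'rV[R]_n) (g : 'rV[R]_n -> 'M[R]_n).
Hypothesis oU : open U.
Hypothesis sg : forall a b, smooth_on U (fun x => g x a b).
Hypothesis gT : forall x, U x -> (g x)^T = g x.
Hypothesis gU : forall x, U x -> g x \in unitmx.

Lemma smooth_ginv a b : smooth_on U (ginv g a b).
Proof. exact: smooth_invmx. Qed.

Lemma smooth_christoffel c a b : smooth_on U (christoffel g c a b).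
Proof.
apply: (smooth_mul oU); first exact: smooth_cst.
apply: (smooth_bigsum oU) => d; apply: (smooth_mul oU); first exact: smooth_ginv.
apply: (smooth_sub oU); last exact: smooth_pd (sg _ _).
by apply: (smooth_add oU); exact: smooth_pd (sg _ _).
Qed.

Section At.
Variable x : 'rV[R]_n.
Hypothesis Ux : U x.
Local Notation dg c a b := (pd c (fun y => g y a b) x).
Local Notation Gam c a b := (christoffel g c a b x).

Lemma metric_comp_sym a b : g x a b = g x b a.
Proof. by rewrite -{1}(gT Ux) mxE. Qed.

Lemma dmetric_sym c a b : dg c a b = dg c b a.
Proof. by apply: (pd_ext c oU Ux) => y Uy; rewrite -{1}(gT Uy) mxE. Qed.

Lemma christoffel_sym c a b : Gam c a b = Gam c b a.
Proof.
rewrite /christoffel; congr (_ * _); apply: eq_bigr => d _.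
by rewrite [dg d a b]dmetric_sym [dg a b d + _]addrC.
Qed.

Lemma christoffel_lower a b c :
  \sum_e Gam e a b * g x e c = 2^-1 * (dg a b c + dg b a c - dg c a b).
Proof.
transitivity (2^-1 * \sum_d (\sum_e g x c e * ginv g e d x) *
    (dg a b d + dg b a d - dg d a b)).
  under [in RHS]eq_bigr => d _ do rewrite mulr_suml.
  rewrite exchange_big /= mulr_sumr; apply: eq_bigr => e _.
  rewrite /christoffel -mulrA; congr (_ * _); rewrite mulr_suml; apply: eq_bigr => d _.
  by rewrite (metric_comp_sym e c); ring.
have K d : \sum_e g x c e * ginv g e d x = (c == d)%:R.
  by have := congr1 (fun M : 'M[R]_n => M c d) (mulmxV (gU Ux)); rewrite !mxE => <-.
congr (_ * _); rewrite (bigD1 c) //= -[X in X * _]/(\sum_e g x c e * ginv g e c x) K eqxx mul1r.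
by rewrite big1 ?addr0 // => d dc; rewrite -[X in X * _]/(\sum_e g x c e * ginv g e d x) K eq_sym (negbTE dc) mul0r.
Qed.

(** With this placement of indices, compatibility of the connection becomes the matrix identity of
    [metric_compatible], to which inverses and traces can be applied. *)
Definition connection_mx c : 'M[R]_n := \matrix_(a, e) Gam e c a.
Definition dmetric_mx c : 'M[R]_n := \matrix_(a, b) dg c a b.
Definition dginv_mx c : 'M[R]_n := \matrix_(a, b) pd c (ginv g a b) x.

Lemma metric_compatible c :
  dmetric_mx c = connection_mx c *m g x + g x *m (connection_mx c)^T.
Proof.
apply/matrixP => a b; rewrite !mxE.
under eq_bigr => e _ do rewrite mxE.
under [X in _ + X]eq_bigr => e _ do rewrite !mxE mulrC metric_comp_sym.
rewrite !christoffel_lower (dmetric_sym c b a).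
by field.
Qed.

(** Differentiating g^-1 g = 1 expresses the derivative of g^-1 by that of g, where
    [metric_compatible] is substituted. *)
Lemma ginv_compatible c :
  dginv_mx c = - (invmx (g x) *m connection_mx c) - (connection_mx c)^T *m invmx (g x).
Proof.
have E : dginv_mx c *m g x + invmx (g x) *m dmetric_mx c = 0.
  apply/matrixP => a b; rewrite !mxE -big_split /=.
  transitivity (pd c (fun y => \sum_j ginv g a j y * g y j b) x).
    rewrite (pd_sum oU Ux); last by move=> j; apply: (smooth_mul oU) => //; exact: smooth_ginv.
    apply: eq_bigr => j _; rewrite (pdM Ux c (smooth_ginv a j) (sg j b)).
    by rewrite !mxE.
  rewrite (pd_ext c oU Ux (g := fun=> (a == b)%:R)) ?pd_cst // => y Uy.
  by rewrite /ginv; have := congr1 (fun M : 'M[R]_n => M a b) (mulVmx (gU Uy)); rewrite !mxE => <-.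
have {}E : dginv_mx c *m g x = - (invmx (g x) *m dmetric_mx c).
  by apply/eqP; rewrite -addr_eq0 E.
rewrite -[LHS](mulmxK (gU Ux)) E metric_compatible mulmxDr mulNmx mulmxDl opprD.
by rewrite !mulmxA mulVmx ?gU // mul1mx -(mulmxA _ (g x)) mulmxV ?gU // mulmx1.
Qed.

(** Jacobi's formula with adj g = det(g) g^-1; each of the two terms in [metric_compatible]
    contributes one trace of the connection matrix, whence the factor 2. *)
Lemma pd_det_metric c : pd c (fun y => \det (g y)) x = 2 * \det (g x) * \tr (connection_mx c).
Proof.
rewrite (pd_det oU c sg Ux).
transitivity (\tr (dmetric_mx c *m \adj (g x))).
  rewrite /mxtrace; apply: eq_bigr => i _; rewrite mxE; apply: eq_bigr => j _.
  by rewrite !mxE.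
have -> : \adj (g x) = \det (g x) *: invmx (g x).
  rewrite /invmx gU // scalerA mulfV ?scale1r //.
  by have := gU Ux; rewrite unitmxE unitfE.
rewrite -scalemxAr mxtraceZ metric_compatible mulmxDl mxtraceD.
rewrite -mulmxA mulmxV ?gU // mulmx1 -mulmxA mxtrace_mulC -mulmxA mulVmx ?gU // mulmx1.
by rewrite mxtrace_tr; ring.
Qed.

End At.
End Metric.

(** * Killing fields: divergence of the field strength dK *)

Section Killing.
Context {R : realType} {n : nat}.
Variables (U : set 'rV[R]_n) (g : 'rV[R]_n -> 'M[R]_n) (K : 'I_n -> 'rV[R]_n -> R).
Hypothesis oU : open U.
Hypothesis sg : forall a b, smooth_on U (fun x => g x a b).
Hypothesis gT : forall x, U x -> (g x)^T = g x.
Hypothesis gU : forall x, U x -> g x \in unitmx.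
Hypothesis sK : forall a, smooth_on U (K a).
Hypothesis killing : forall x, U x -> forall a b, lie_metric g K a b x = 0.

Definition nablaK (e c : 'I_n) : 'rV[R]_n -> R :=
  fun y => pd e (K c) y + \sum_f christoffel g c e f y * K f y.

Lemma smooth_flat a : smooth_on U (flat g K a).
Proof. by apply: (smooth_bigsum oU) => b; exact: (smooth_mul oU (sg a b) (sK b)). Qed.

Let sGam c a b : smooth_on U (christoffel g c a b).
Proof. exact: smooth_christoffel. Qed.

Let sGK c e f : smooth_on U (fun y => christoffel g c e f y * K f y).
Proof. exact: (smooth_mul oU (sGam c e f) (sK f)). Qed.

Lemma smooth_nablaK e c : smooth_on U (nablaK e c).
Proof.
apply: (smooth_add oU); first exact: smooth_pd (sK c).
by apply: (smooth_bigsum oU) => f; exact: sGK.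
Qed.

Section At.
Variable x : 'rV[R]_n.
Hypothesis Ux : U x.
Local Notation dg c a b := (pd c (fun y => g y a b) x).
Local Notation Gam c a b := (christoffel g c a b x).

Let Gs c a b : Gam c a b = Gam c b a.
Proof. exact: christoffel_sym oU gT _ Ux c a b. Qed.

Lemma nablaK_lower a b : \sum_c nablaK a c x * g x c b =
  \sum_c pd a (K c) x * g x c b +
  \sum_f 2^-1 * (dg a f b + dg f a b - dg b a f) * K f x.
Proof.
transitivity (\sum_c (pd a (K c) x * g x c b + \sum_f Gam c a f * K f x * g x c b)).
  by apply: eq_bigr => c _; rewrite mulrDl mulr_suml.
rewrite big_split /=; congr (_ + _); rewrite exchange_big /=.
apply: eq_bigr => f _; rewrite -(christoffel_lower gT gU Ux) mulr_suml.
by apply: eq_bigr => c _; ring.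
Qed.

(** Killing's equation in covariant form: the Lie derivative of the metric is the symmetrised
    derivative nabla_a K_b + nabla_b K_a. *)
Lemma nablaK_antisym a b :
  \sum_c nablaK a c x * g x c b = - \sum_c nablaK b c x * g x c a.
Proof.
apply/eqP; rewrite -addr_eq0; apply/eqP; apply: etrans (killing Ux a b).
rewrite !nablaK_lower /lie_metric addrACA -!big_split /=; apply: eq_bigr => c _.
rewrite (metric_comp_sym gT Ux c a) (dmetric_sym oU gT Ux a c b) (dmetric_sym oU gT Ux b a c).
rewrite (dmetric_sym oU gT Ux c b a) (dmetric_sym oU gT Ux b c a) (dmetric_sym oU gT Ux a b c).
by field.
Qed.

(** The exterior derivative of K is nabla_a K_b - nabla_b K_a, and antisymmetry makes both terms
    equal. *)
Lemma d1_flat a b : d1 (flat g K) a b x = 2 * \sum_c nablaK a c x * g x c b.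
Proof.
have pf a' b' : pd a' (flat g K b') x = \sum_c (dg a' b' c * K c x + g x b' c * pd a' (K c) x).
  rewrite (pd_sum oU Ux); last by move=> c; exact: (smooth_mul oU (sg b' c) (sK c)).
  by apply: eq_bigr => c _; rewrite (pdM Ux a' (sg b' c) (sK c)).
transitivity (\sum_c nablaK a c x * g x c b - \sum_c nablaK b c x * g x c a); last first.
  by rewrite [X in _ - X]nablaK_antisym; ring.
rewrite /d1 !pf !nablaK_lower opprD addrACA -!sumrN -!big_split /=.
apply: eq_bigr => c _.
rewrite (metric_comp_sym gT Ux c a) (metric_comp_sym gT Ux c b) (dmetric_sym oU gT Ux a c b).
rewrite (dmetric_sym oU gT Ux c b a) (dmetric_sym oU gT Ux b c a).
by field.
Qed.

Let h := invmx (g x).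
Let N : 'M[R]_n := \matrix_(e, c) nablaK e c x.

Let Ng_anti : (N *m g x)^T = - (N *m g x).
Proof.
apply/matrixP => a b; rewrite !mxE.
under eq_bigr do rewrite mxE; under [in RHS]eq_bigr do rewrite mxE.
exact: nablaK_antisym.
Qed.

Let hT : h^T = h. Proof. by rewrite /h trmx_inv gT. Qed.

(** The trace pairs the antisymmetric [N *m g x] with the symmetric inverse metric, hence equals its
    own negative. *)
Lemma nablaK_trace : \sum_c nablaK c c x = 0.
Proof.
have -> : \sum_c nablaK c c x = \tr N by apply: eq_bigr => c _; rewrite mxE.
have E : N = N *m g x *m h by rewrite mulmxK ?gU.
suff : \tr N = - \tr N by move=> H; lra.
rewrite {1}E -mxtrace_tr trmx_mul Ng_anti hT mulmxN linearN /= mxtrace_mulC.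
by rewrite -E.
Qed.

Let hN_anti a b : (h *m N) a b = - (h *m N) b a.
Proof.
have E : h *m N = h *m (N *m g x) *m h by rewrite mulmxA mulmxK ?gU.
have : (h *m N)^T = - (h *m N).
  rewrite {1}E !trmx_mul hT -trmx_mul Ng_anti mulNmx mulmxN.
  by rewrite mulmxA -E.
by move/(congr1 (fun M : 'M[R]_n => M b a)); rewrite !mxE.
Qed.

(** The field is written as -2 nabla^b K^a rather than 2 nabla^a K^b, so that its divergence over a
    meets nabla_a nabla_e K^a, the expression in the contracted Ricci identity. *)
Lemma raise2_d1_flat a b :
  raise2 g (d1 (flat g K)) a b x = - 2 * \sum_e ginv g b e x * nablaK e a x.
Proof.
have -> : \sum_e ginv g b e x * nablaK e a x = (h *m N) b a.
  by rewrite mxE; apply: eq_bigr => e _; rewrite mxE.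
rewrite mulNr -mulrN -hN_anti.
have E : h *m N = h *m (N *m g x) *m h^T by rewrite hT mulmxA mulmxK ?gU.
rewrite E mxE /raise2 exchange_big /= mulr_sumr; apply: eq_bigr => d _.
rewrite !mxE mulr_suml mulr_sumr; apply: eq_bigr => c _.
rewrite d1_flat mxE.
have -> : \sum_c0 nablaK c c0 x * g x c0 d = \sum_j N c j * g x j d.
  by apply: eq_bigr => j _; rewrite mxE.
rewrite /ginv -/h; ring.
Qed.

(** The Christoffel symbol is symmetric in c and f, the raised derivative nabla^f K^c
    antisymmetric. *)
Lemma christoffel_nablaK d :
  \sum_c \sum_f Gam d c f * (\sum_e ginv g f e x * nablaK e c x) = 0.
Proof.
have hNE f c : \sum_e ginv g f e x * nablaK e c x = (h *m N) f c.
  by rewrite mxE; apply: eq_bigr => e _; rewrite mxE.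
under eq_bigr => c _ do under eq_bigr => f _ do rewrite hNE.
suff : \sum_c \sum_f Gam d c f * (h *m N) f c = - \sum_c \sum_f Gam d c f * (h *m N) f c.
  by move=> H; lra.
rewrite {1}exchange_big /= -sumrN; apply: eq_bigr => c _.
by rewrite -sumrN; apply: eq_bigr => f _; rewrite hN_anti Gs; ring.
Qed.
End At.

Section Divergence.
Variable x : 'rV[R]_n.
Hypothesis Ux : U x.
Local Notation Gam c a b := (christoffel g c a b x).

Let Gs c a b : Gam c a b = Gam c b a.
Proof. exact: christoffel_sym oU gT _ Ux c a b. Qed.

(* Contracted Ricci identity [nabla_c nabla_e K^c = R_{fe} K^f]; it uses
   [nabla_c K^c = 0]. *)
Lemma div_nablaK e :
  \sum_c (pd c (nablaK e c) x + (\sum_f Gam f c f) * nablaK e c x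
          - \sum_f Gam f c e * nablaK f c x) =
  \sum_f ricci g f e x * K f x.
Proof.
have pN a b c : pd a (nablaK b c) x = pd a (pd b (K c)) x +
    (\sum_f pd a (christoffel g c b f) x * K f x + \sum_f Gam c b f * pd a (K f) x).
  rewrite (pdD Ux a (smooth_pd b (sK c))); last first.
    by apply: (smooth_bigsum oU) => f; exact: sGK.
  rewrite (pd_sum oU Ux); last by move=> f; exact: sGK.
  rewrite -big_split /=.
  by congr (_ + _); apply: eq_bigr => f _; rewrite (pdM Ux a (sGam c b f) (sK f)).
have regroup (a s1 s2 s3 s4 s5 s6 s7 s8 : R) :
    a + (s1 + s2) + (s3 + s4) - (s5 + s6) - (a + (s7 + s8)) =
    s1 - s7 + (s4 - s6) + (s2 - s5) + (s3 - s8) by ring.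
have factor (p q u v k : R) : p * k - q * k + (u * k - v * k) = (p - q + (u - v)) * k.
  by ring.
(* Subtracting this zero turns the divergence into a commutator of covariant derivatives, in which
   the second derivatives of K cancel. *)
have T0 : \sum_c pd e (nablaK c c) x = 0.
  rewrite -(pd_sum oU Ux); last by move=> c; exact: smooth_nablaK.
  by rewrite (pd_ext e oU Ux (g := fun=> 0)) ?pd_cst //; exact: nablaK_trace.
transitivity (\sum_c (pd c (nablaK e c) x + (\sum_f Gam f c f) * nablaK e c x
    - \sum_f Gam f c e * nablaK f c x) - \sum_c pd e (nablaK c c) x).
  by rewrite T0 subr0.
rewrite -sumrN -big_split /=.
(* What remains after this cancellation: S1, S7 (derivatives of Christoffel symbols) and S4, S6
   (quadratic terms) assemble into the Ricci tensor, while S2 cancels S5 and S3 cancels S8 by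
   symmetry of the lower indices. *)
pose S1 c := \sum_f pd c (christoffel g c e f) x * K f x.
pose S2 c := \sum_f Gam c e f * pd c (K f) x.
pose S3 c := (\sum_f Gam f c f) * pd e (K c) x.
pose S4 c := (\sum_f Gam f c f) * \sum_f Gam c e f * K f x.
pose S5 c := \sum_f Gam f c e * pd f (K c) x.
pose S6 c := \sum_f Gam f c e * \sum_h Gam c f h * K h x.
pose S7 c := \sum_f pd e (christoffel g c c f) x * K f x.
pose S8 c := \sum_f Gam c c f * pd e (K f) x.
have -> : \sum_c (pd c (nablaK e c) x + (\sum_f Gam f c f) * nablaK e c x
    - \sum_f Gam f c e * nablaK f c x + - pd e (nablaK c c) x) =
  \sum_c (S1 c - S7 c + (S4 c - S6 c) + (S2 c - S5 c) + (S3 c - S8 c)).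
  apply: eq_bigr => c _; rewrite !pN (pd_comm c e oU (sK c) Ux).
  have -> : \sum_f Gam f c e * nablaK f c x = S5 c + S6 c.
    by rewrite -big_split /=; apply: eq_bigr => f _; rewrite -mulrDr.
  have -> : (\sum_f Gam f c f) * nablaK e c x = S3 c + S4 c by rewrite -mulrDr.
  exact: regroup.
have H25 : \sum_c S2 c = \sum_c S5 c.
  rewrite exchange_big; apply: eq_bigr => c _; apply: eq_bigr => f _.
  by rewrite Gs.
have H38 : \sum_c S3 c = \sum_c S8 c.
  rewrite [RHS]exchange_big; apply: eq_bigr => c _; rewrite /S3 mulr_suml.
  by apply: eq_bigr => f _; rewrite Gs.
pose T4 f := \sum_c (\sum_h Gam c c h * Gam h e f) * K f x.
pose T6 f := \sum_c (\sum_h Gam c e h * Gam h c f) * K f x.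
have H4 : \sum_c S4 c = \sum_f T4 f.
  transitivity (\sum_c \sum_f \sum_h Gam h c h * Gam c e f * K f x).
    apply: eq_bigr => c _; rewrite /S4 mulr_sumr; apply: eq_bigr => f _.
    by rewrite mulr_suml; apply: eq_bigr => h _; rewrite mulrA.
  rewrite exchange_big; apply: eq_bigr => f _.
  rewrite exchange_big; apply: eq_bigr => c _; rewrite mulr_suml.
  by apply: eq_bigr => h _; rewrite (Gs c h c).
have H6 : \sum_c S6 c = \sum_f T6 f.
  transitivity (\sum_c \sum_h \sum_f Gam f c e * Gam c f h * K h x).
    apply: eq_bigr => c _; rewrite exchange_big; apply: eq_bigr => f _.
    by rewrite mulr_sumr; apply: eq_bigr => h _; rewrite mulrA.
  rewrite exchange_big; apply: eq_bigr => f _.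
  rewrite exchange_big; apply: eq_bigr => c _; rewrite mulr_suml.
  by apply: eq_bigr => h _; rewrite (Gs c h e).
have H17 : \sum_c S1 c - \sum_c S7 c + (\sum_f T4 f - \sum_f T6 f) =
    \sum_f ricci g f e x * K f x.
  transitivity (\sum_f \sum_c pd c (christoffel g c e f) x * K f x -
      \sum_f \sum_c pd e (christoffel g c c f) x * K f x + (\sum_f T4 f - \sum_f T6 f)).
    by congr (_ - _ + _); rewrite [RHS]exchange_big.
  rewrite -!sumrN -!big_split; apply: eq_bigr => f _.
  rewrite /ricci /T4 /T6 mulr_suml -!sumrN -!big_split; apply: eq_bigr => c _.
  apply: etrans (factor _ _ _ _ _) _; congr (_ * _); rewrite /riemann; congr (_ + _).
  by rewrite sumrB.
clearbody S1 S2 S3 S4 S5 S6 S7 S8 T4 T6.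
by rewrite !big_split /= !sumrN H25 H38 H4 H6 !subrr !addr0.
Qed.

(** A density s with this logarithmic derivative makes the coordinate divergence of s F^{cd} equal
    to s nabla_c F^{cd} for antisymmetric F. By [raise2_d1_flat] and [div_nablaK] this is -2 s times
    the Ricci tensor applied to K, with one index raised. *)
Lemma div_raise2_d1_flat (s : 'rV[R]_n -> R) d : smooth_on U s ->
  (forall c, pd c s x = s x * \sum_f Gam f c f) ->
  (forall a b, ricci g a b x = 0) ->
  \sum_c pd c (fun y => s y * raise2 g (d1 (flat g K)) c d y) x = 0.
Proof.
move=> ss ds ric.
have shN c e : smooth_on U (fun y => ginv g d e y * nablaK e c y).
  by apply: (smooth_mul oU); [exact: smooth_ginv|exact: smooth_nablaK].
have dh c e : pd c (ginv g d e) x =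
    - (\sum_f ginv g d f x * Gam e c f) - \sum_f Gam d c f * ginv g f e x.
  have := congr1 (fun M : 'M[R]_n => M d e) (ginv_compatible oU sg gT gU Ux c).
  rewrite !mxE => ->; congr (- _ - _).
    by apply: eq_bigr => f _; rewrite !mxE.
  by apply: eq_bigr => f _; rewrite !mxE.
have pc c : pd c (fun y => s y * raise2 g (d1 (flat g K)) c d y) x =
   - 2 * s x * (\sum_e ginv g d e x * (pd c (nablaK e c) x + (\sum_f Gam f c f) * nablaK e c x)
     + \sum_e pd c (ginv g d e) x * nablaK e c x).
  rewrite (pd_ext c oU Ux (g := fun y => - 2 * (s y * \sum_e ginv g d e y * nablaK e c y))); last first.
    by move=> y Uy; rewrite (raise2_d1_flat Uy); ring.
  have sS : smooth_on U (fun y => \sum_e ginv g d e y * nablaK e c y).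
    by apply: (smooth_bigsum oU) => e; exact: shN.
  rewrite (pdZ Ux c _ (smooth_mul oU ss sS)) (pdM Ux c ss sS) ds.
  rewrite (pd_sum oU Ux _ _ _ (shN c)).
  rewrite -!mulrA; congr (_ * _); rewrite -mulrDr; congr (_ * _).
  rewrite mulr_sumr -!big_split /=; apply: eq_bigr => e _.
  by rewrite (pdM Ux c (smooth_ginv oU sg gU d e) (smooth_nablaK e c)); ring.
(* The derivative of the inverse metric has two parts: the first supplies the connection term for
   the index e that [div_nablaK] contains, the second vanishes by [christoffel_nablaK]. *)
have first_term : \sum_c \sum_e (\sum_f ginv g d f x * Gam e c f) * nablaK e c x =
    \sum_c \sum_e ginv g d e x * \sum_f Gam f c e * nablaK f c x.
  apply: eq_bigr => c _.
  under eq_bigr => e _ do rewrite mulr_suml.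
  rewrite exchange_big; apply: eq_bigr => f _ /=.
  by rewrite mulr_sumr; apply: eq_bigr => e _; rewrite mulrA.
have second_term : \sum_c \sum_e (\sum_f Gam d c f * ginv g f e x) * nablaK e c x = 0.
  apply: etrans (christoffel_nablaK Ux d); apply: eq_bigr => c _.
  under eq_bigr => e _ do rewrite mulr_suml.
  rewrite exchange_big; apply: eq_bigr => f _ /=.
  by rewrite mulr_sumr; apply: eq_bigr => e _; rewrite mulrA.
have dhN : \sum_c \sum_e pd c (ginv g d e) x * nablaK e c x =
    - \sum_c \sum_e ginv g d e x * \sum_f Gam f c e * nablaK f c x.
  transitivity (- (\sum_c \sum_e (\sum_f ginv g d f x * Gam e c f) * nablaK e c x)
      - \sum_c \sum_e (\sum_f Gam d c f * ginv g f e x) * nablaK e c x); last first.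
    by rewrite first_term second_term subr0.
  rewrite -!sumrN -big_split /=.
  apply: eq_bigr => c _; rewrite -!sumrN -big_split /=; apply: eq_bigr => e _.
  by rewrite dh; ring.
under eq_bigr => c _ do rewrite pc.
rewrite -mulr_sumr big_split /= dhN -sumrN -big_split /=.
rewrite (_ : \sum_c _ = 0) ?mulr0 //.
under eq_bigr => c _ do rewrite -sumrN -big_split /=.
rewrite exchange_big big1 // => e _.
have factor3 (p a b c : R) : p * (a + b) + - (p * c) = p * (a + b - c) by ring.
under eq_bigr => c _ do rewrite factor3.
rewrite -mulr_sumr div_nablaK big1 ?mulr0 // => f _.
by rewrite ric mul0r.
Qed.
End Divergence.
End Killing.

(** * Lorentzian metrics in dimension four: the volume density and closed duals *)

Section Lorentzian.
Context {R : realType}.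

Lemma det_minkowski :
  \det (\matrix_(i < 4, j < 4) ((if val i == 0%N then -1 else 1 : R) *+ (i == j))) = -1.
Proof. by rewrite det4_ord !mxE /=; ring. Qed.

Lemma lorentzian_det (g : 'M[R]_4) : lorentzian_form g -> \det g < 0.
Proof.
move=> [_ [P Pu E]].
have := congr1 (fun M => \det M) E.
rewrite det_minkowski !det_mulmx det_tr mulrAC -expr2 => D.
have P0 : 0 < \det P ^+ 2.
  by rewrite exprn_even_gt0 //=; move: Pu; rewrite unitmxE unitfE.
by rewrite -(pmulr_rlt0 _ P0) D ltrN10.
Qed.

Lemma lorentzian_unit (g : 'M[R]_4) : lorentzian_form g -> g \in unitmx.
Proof. by move=> /lorentzian_det D; rewrite unitmxE unitfE lt_eqF. Qed.

Definition sqrt_det (g : 'rV[R]_4 -> 'M[R]_4) x := Num.sqrt `|\det (g x)|.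

Lemma hodge2E (g : 'rV[R]_4 -> 'M[R]_4) (F : 'I_4 -> 'I_4 -> 'rV[R]_4 -> R) a b x :
  hodge2 g F a b x = star4 (sqrt_det g x) (invmx (g x)) (fun c d => F c d x) a b.
Proof. by []. Qed.

(** With D e i j in the role of the derivative by x^e of the density s F^{ij}, each component of d
    of the dual is, up to sign, a single divergence, or zero when indices repeat. *)
Lemma dual_table_closed (D : 'I_4 -> 'I_4 -> 'I_4 -> R) a b c :
  (forall d, \sum_e D e e d = 0) -> (forall e i j, D e i j = - D e j i) ->
  dual_table (D a) b c - dual_table (D b) a c + dual_table (D c) a b = 0.
Proof.
move=> div DA.
have D0 e i : D e i i = 0 by have := DA e i i; lra.
have := div i3; have := div i2; have := div i1; have := div i0.
rewrite !sum4 !D0 !(DA _ i1 i0) !(DA _ i2 i0) !(DA _ i3 i0) !(DA _ i2 i1) !(DA _ i3 i1) !(DA _ i3 i2).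
move=> E0 E1 E2 E3.
by move: c; apply: ord4P; move: b; apply: ord4P; move: a; apply: ord4P; rewrite /dual_table /=; lra.
Qed.
Lemma pd_dual_table (U : set 'rV[R]_4) (s : 'rV[R]_4 -> R)
    (G : 'I_4 -> 'I_4 -> 'rV[R]_4 -> R) x (oU : open U) (Ux : U x) e a b :
  (forall c d, smooth_on U (fun y => s y * G c d y)) ->
  pd e (fun y => s y * dual_table (fun c d => G c d y) a b) x =
  dual_table (fun c d => pd e (fun y => s y * G c d y) x) a b.
Proof.
move=> sH.
have N c d : pd e (fun y => s y * - G c d y) x = - pd e (fun y => s y * G c d y) x.
  rewrite -(pdN Ux e (sH c d)); apply: (pd_ext e oU Ux) => y _.
  by rewrite mulrN.
have Z : pd e (fun y => s y * 0) x = 0.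
  by rewrite -[RHS](pd_cst e 0 x); apply: (pd_ext e oU Ux) => y _; rewrite mulr0.
by move: b; apply: ord4P; move: a; apply: ord4P; rewrite /dual_table /= ?N ?Z.
Qed.

Section Chart.
Variables (U : set 'rV[R]_4) (g : 'rV[R]_4 -> 'M[R]_4).
Hypothesis oU : open U.
Hypothesis sg : forall a b, smooth_on U (fun x => g x a b).
Hypothesis lor : forall x, U x -> lorentzian_form (g x).

Let gT x : U x -> (g x)^T = g x. Proof. by move=> /lor []. Qed.
Let gU x : U x -> g x \in unitmx. Proof. by move=> /lor /lorentzian_unit. Qed.

Lemma sqrt_det_sqr x : U x -> sqrt_det g x * sqrt_det g x = - \det (g x).
Proof.
by move=> /lor/lorentzian_det D; rewrite -expr2 sqr_sqrtr // ltr0_norm.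
Qed.

(** The determinant is negative on U, so its absolute value is there the smooth positive function -
    det g. *)
Lemma smooth_sqrt_det : smooth_on U (sqrt_det g).
Proof.
have D x : U x -> 0 < - \det (g x) by move=> /lor/lorentzian_det; rewrite oppr_gt0.
apply: smooth_ext oU _ (smooth_sqrt oU D (smooth_opp oU (smooth_det oU sg))) => x Ux.
by rewrite /sqrt_det ltr0_norm // lorentzian_det //; exact: lor.
Qed.

(** Differentiating s^2 = - det g gives 2 s ds = 2 s^2 times the trace of the connection, and s
    cancels since it is nonzero. *)
Lemma pd_sqrt_det c x : U x ->
  pd c (sqrt_det g) x = sqrt_det g x * \sum_f christoffel g f c f x.
Proof.
move=> Ux.
have s0 : sqrt_det g x != 0.
  by rewrite sqrtr_eq0 -ltNge normr_gt0 lt_eqF // lorentzian_det //; exact: lor.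
have := pdM Ux c smooth_sqrt_det smooth_sqrt_det.
rewrite (pd_ext c oU Ux (fun y Uy => sqrt_det_sqr Uy)).
rewrite (pdN Ux c (smooth_det oU sg)) (pd_det_metric oU sg gT gU Ux c).
have -> : \tr (connection_mx g x c) = \sum_f christoffel g f c f x.
  by apply: eq_bigr => f _; rewrite mxE.
have -> : - (2 * \det (g x) * \sum_f christoffel g f c f x) =
    2 * (sqrt_det g x * sqrt_det g x) * \sum_f christoffel g f c f x.
  by rewrite sqrt_det_sqr //; ring.
move=> E; apply: (mulfI s0); move: E.
set p := pd c _ x; set s := sqrt_det g x; set t := \sum_f _.
by clearbody p s t => E; lra.
Qed.

Lemma hodge2_hodge2 (F : 'I_4 -> 'I_4 -> 'rV[R]_4 -> R) a b x : U x ->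
  (forall c d, F c d x = - F d c x) -> hodge2 g (hodge2 g F) a b x = - F a b x.
Proof.
move=> Ux A; apply: (@star4_involution R (sqrt_det g x) (invmx (g x)) (fun c d => F c d x)).
- by rewrite trmx_inv gT.
- rewrite expr2 sqrt_det_sqr // det_inv mulNr mulfV //.
  by have := gU Ux; rewrite unitmxE unitfE.
- exact: A.
Qed.

Lemma smooth_raise2 (F : 'I_4 -> 'I_4 -> 'rV[R]_4 -> R) a b :
  (forall c d, smooth_on U (F c d)) -> smooth_on U (raise2 g F a b).
Proof.
move=> sF; apply: (smooth_bigsum oU) => c; apply: (smooth_bigsum oU) => d.
apply: (smooth_mul oU) (sF c d).
exact: (smooth_mul oU (smooth_ginv oU sg gU a c) (smooth_ginv oU sg gU b d)).
Qed.

Section Divergence.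
Variables (F : 'I_4 -> 'I_4 -> 'rV[R]_4 -> R).
Hypothesis sF : forall a b, smooth_on U (F a b).
Hypothesis FA : forall a b x, F a b x = - F b a x.
Let H c d : 'rV[R]_4 -> R := fun y => sqrt_det g y * raise2 g F c d y.

Let sH c d : smooth_on U (H c d).
Proof. exact: (smooth_mul oU smooth_sqrt_det (smooth_raise2 c d sF)). Qed.

Let HA c d y : H c d y = - H d c y.
Proof.
rewrite /H -mulrN; congr (_ * _).
exact: (raise4_anti (invmx (g y)) c d (fun a b => FA a b y)).
Qed.

Lemma pd_hodge2 e a b x : U x ->
  pd e (hodge2 g F a b) x = dual_table (fun c d => pd e (H c d) x) a b.
Proof.
move=> Ux.
have E y : hodge2 g F a b y = sqrt_det g y * dual_table (fun c d => raise2 g F c d y) a b.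
  rewrite hodge2E /star4; apply: eps_contract => c d.
  exact: (raise4_anti (invmx (g y)) c d (fun a b => FA a b y)).
rewrite (_ : hodge2 g F a b = fun y => sqrt_det g y *
  dual_table (fun c d => raise2 g F c d y) a b); last exact/funext.
exact: (pd_dual_table oU Ux e a b sH).
Qed.

Lemma d2_hodge2_eq0 a b c x : U x -> (forall d, \sum_e pd e (H e d) x = 0) ->
  d2 (hodge2 g F) a b c x = 0.
Proof.
move=> Ux div; rewrite /d2 !pd_hodge2 //.
have DA e i j : pd e (H i j) x = - pd e (H j i) x.
  by rewrite -(pdN Ux e (sH j i)); apply: (pd_ext e oU Ux) => y _; exact: HA.
exact: (dual_table_closed (D := fun e i j => pd e (H i j) x)).
Qed.
End Divergence.

End Chart.
End Lorentzian.

(** * Exterior calculus of families *)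

Section ExteriorCalculus.
Context {R : realType} {n : nat}.
Variable U : set 'rV[R]_n.
Hypothesis oU : open U.

Lemma d1_ext (A B : 'I_n -> 'rV[R]_n -> R) a b x : U x ->
  (forall a y, U y -> A a y = B a y) -> d1 A a b x = d1 B a b x.
Proof.
move=> Ux AB; rewrite /d1.
by rewrite (pd_ext a oU Ux (AB b)) (pd_ext b oU Ux (AB a)).
Qed.

Lemma d2_ext (F G : 'I_n -> 'I_n -> 'rV[R]_n -> R) a b c x : U x ->
  (forall a b y, U y -> F a b y = G a b y) -> d2 F a b c x = d2 G a b c x.
Proof.
move=> Ux FG; rewrite /d2.
by rewrite (pd_ext a oU Ux (FG b c)) (pd_ext b oU Ux (FG a c)) (pd_ext c oU Ux (FG a b)).
Qed.

Lemma d3_ext (F G : 'I_n -> 'I_n -> 'I_n -> 'rV[R]_n -> R) a b c d x : U x ->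
  (forall a b c y, U y -> F a b c y = G a b c y) -> d3 F a b c d x = d3 G a b c d x.
Proof.
move=> Ux FG; rewrite /d3.
rewrite (pd_ext a oU Ux (FG b c d)) (pd_ext b oU Ux (FG a c d)).
by rewrite (pd_ext c oU Ux (FG a b d)) (pd_ext d oU Ux (FG a b c)).
Qed.

Lemma d1_antisym (A : 'I_n -> 'rV[R]_n -> R) a b x : d1 A a b x = - d1 A b a x.
Proof. by rewrite /d1 opprB. Qed.

Lemma smooth_d1 (A : 'I_n -> 'rV[R]_n -> R) a b :
  (forall a, smooth_on U (A a)) -> smooth_on U (d1 A a b).
Proof. by move=> sA; apply: (smooth_sub oU); exact: smooth_pd. Qed.

Lemma d2_d1 (A : 'I_n -> 'rV[R]_n -> R) a b c x : U x ->
  (forall a, smooth_on U (A a)) -> d2 (d1 A) a b c x = 0.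
Proof.
move=> Ux sA; have sp i j := smooth_pd i (sA j).
rewrite /d2 /d1 !(pdB Ux _ (sp _ _) (sp _ _)).
rewrite (pd_comm a b oU (sA c) Ux) (pd_comm a c oU (sA b) Ux) (pd_comm b c oU (sA a) Ux).
have cancel (p q r : R) : p - q - (p - r) + (q - r) = 0 by ring.
exact: cancel.
Qed.

Lemma pd_d2 (F : 'I_n -> 'I_n -> 'rV[R]_n -> R) e a b c x : U x ->
  (forall a b, smooth_on U (F a b)) ->
  pd e (d2 F a b c) x = pd e (pd a (F b c)) x - pd e (pd b (F a c)) x + pd e (pd c (F a b)) x.
Proof.
move=> Ux sF; have sp i j k := smooth_pd i (sF j k).
rewrite (pdD Ux e (smooth_sub oU (sp a b c) (sp b a c)) (sp c a b)).
by rewrite (pdB Ux e (sp a b c) (sp b a c)).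
Qed.

Lemma d3_d2 (F : 'I_n -> 'I_n -> 'rV[R]_n -> R) a b c d x : U x ->
  (forall a b, smooth_on U (F a b)) -> d3 (d2 F) a b c d x = 0.
Proof.
move=> Ux sF; rewrite /d3 !(pd_d2 _ _ _ _ Ux sF).
rewrite (pd_comm a b oU (sF c d) Ux) (pd_comm a c oU (sF b d) Ux) (pd_comm a d oU (sF b c) Ux).
rewrite (pd_comm b c oU (sF a d) Ux) (pd_comm b d oU (sF a c) Ux) (pd_comm c d oU (sF a b) Ux).
have cancel (p q r s t w : R) :
  p - q + r - (p - s + t) + (q - s + w) - (r - t + w) = 0 by ring.
exact: cancel.
Qed.

Lemma d2_scale (f : 'rV[R]_n -> R) (F : 'I_n -> 'I_n -> 'rV[R]_n -> R) a b c x : U x ->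
  smooth_on U f -> (forall a b, smooth_on U (F a b)) ->
  d2 (fun a b y => f y * F a b y) a b c x = wedge12 (d0 f) F a b c x + f x * d2 F a b c x.
Proof.
move=> Ux sf sF; rewrite /d2 !(pdM Ux _ sf (sF _ _)).
have regroup (a1 b1 c1 a2 b2 c2 a3 b3 c3 k : R) :
  a1 * b1 + k * c1 - (a2 * b2 + k * c2) + (a3 * b3 + k * c3) =
  a1 * b1 - a2 * b2 + a3 * b3 + k * (c1 - c2 + c3) by ring.
exact: regroup.
Qed.

Lemma d2B (F G : 'I_n -> 'I_n -> 'rV[R]_n -> R) a b c x : U x ->
  (forall a b, smooth_on U (F a b)) -> (forall a b, smooth_on U (G a b)) ->
  d2 (fun a b y => F a b y - G a b y) a b c x = d2 F a b c x - d2 G a b c x.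
Proof.
move=> Ux sF sG; rewrite /d2 !(pdB Ux _ (sF _ _) (sG _ _)).
have regroup (p q r p' q' r' : R) : p - p' - (q - q') + (r - r') = p - q + r - (p' - q' + r').
  by ring.
exact: regroup.
Qed.

Lemma d2Z (k : R) (F : 'I_n -> 'I_n -> 'rV[R]_n -> R) a b c x : U x ->
  (forall a b, smooth_on U (F a b)) ->
  d2 (fun a b y => k * F a b y) a b c x = k * d2 F a b c x.
Proof. by move=> Ux sF; rewrite /d2 !(pdZ Ux _ k (sF _ _)) -mulrBr -mulrDr. Qed.

End ExteriorCalculus.

(** * Families of forms and their lambda-derivatives *)

Section FieldFamilies.
Context {R : realType} {n : nat}.

Lemma joint_pt_continuous (p : R * 'rV[R]_n) :
  {for p, continuous (fun z : R * 'rV[R]_n => joint_pt z.1 z.2)}.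
Proof.
move=> P /nbhs_rVP[r r0 rP].
exists ([set la : R | `|la - p.1| < r], [set y : 'rV[R]_n | forall j, `|y ord0 j - p.2 ord0 j| < r]).
  split => /=; last by apply/nbhs_rVP; exists r.
  by apply/nbhs_ballP; exists r => // la; rewrite /ball /= distrC.
move=> [la y] [/= lar yr]; apply: rP => k; case: (split_ordP k) => j ->.
  by rewrite [j]ord1 !joint_pt_lshift.
by rewrite !joint_pt_rshift; exact: yr.
Qed.

Lemma smooth_family_continuous (D : set (R * 'rV[R]_n)) f p : smooth_family_on D f -> D p ->
  {for p, continuous (fun z : R * 'rV[R]_n => f z.1 z.2)}.
Proof.
move=> sf Dp.
have E : (fun z : R * 'rV[R]_n => f z.1 z.2) = joint f \o (fun z => joint_pt z.1 z.2).
  by apply/funext => z /=; rewrite joint_ptE.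
rewrite E; apply: (@continuous_comp _ _ _ (fun z : R * 'rV[R]_n => joint_pt z.1 z.2) (joint f)).
  exact: joint_pt_continuous.
apply: (smooth_continuous (family_smooth sf)).
by rewrite joint_domE -surjective_pairing.
Qed.

Lemma comp_dom_open m (D : set (R * 'rV[R]_n)) (E : set (R * 'rV[R]_m))
    (u : R -> 'rV[R]_n -> 'rV[R]_m) : open D -> open E ->
  (forall k, smooth_family_on D (fun la x => u la x ord0 k)) ->
  open [set z | D z /\ E (z.1, u z.1 z.2)].
Proof.
move=> oD oE su; rewrite openE => p [Dp Ep]; rewrite /interior.
have nD : \forall z \near p, D z by exact: (open_nbhs_nbhs (conj oD Dp)).
have nE : nbhs (p.1, u p.1 p.2) E by exact: (open_nbhs_nbhs (conj oE Ep)).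
case: nE => -[A B] [/= A0 /nbhs_rVP[r r0 rB]] AB.
have nA : \forall z \near p, A z.1.
  by case: p A0 {Dp Ep nD r0 rB AB} => la x A0; apply: (cvg_fst (F := nbhs la) (G := nbhs x)).
have nB : \forall z \near p, forall k, `|u z.1 z.2 ord0 k - u p.1 p.2 ord0 k| < r.
  have H (k : 'I_m) : \forall z \near p, `|u z.1 z.2 ord0 k - u p.1 p.2 ord0 k| < r.
    have := smooth_family_continuous (su k) Dp.
    move/(@cvgrPdist_lt _ _ _ (nbhs p) (nbhs_filter p))/(_ _ r0).
    by apply: filterS => z; rewrite distrC.
  exact: (filter_forall (nbhs_filter p) H).
apply: filterS3 nD nA nB => z Dz Az Bz; split => //.
by apply: AB; split => //=; exact: rB.
Qed.

Lemma smooth_family_lambda (D : set (R * 'rV[R]_n)) : smooth_family_on D (fun la _ => la).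
Proof.
rewrite /smooth_family_on (_ : (fun z => _) = fun z : 'rV[R]_(1 + n) => z ord0 (lshift n ord0)).
  exact: smooth_coord.
by apply/funext => z; rewrite mxE.
Qed.

Lemma dlambda_lambda (x : 'rV[R]_n) : dlambda (fun la _ => la) x = 1.
Proof. by rewrite /dlambda pd_lshift_slice derive_id. Qed.

(** Converts an expansion hypothesis into pointwise identities: the remainder has zero value and
    zero lambda-derivative at 0, so f agrees there with f0 + lambda f1 to first order. *)
Lemma affine_jet (D : set (R * 'rV[R]_n)) (U : set 'rV[R]_n) f f0 f1 x :
  open D -> open U -> (forall z, D z -> U z.2) -> D (0, x) ->
  smooth_family_on D f -> smooth_on U f0 -> smooth_on U f1 ->
  Olambda2 U (fun la x => f la x - (f0 x + la * f1 x)) ->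
  f 0 x = f0 x /\ dlambda f x = f1 x.
Proof.
move=> oD oU DU Dx sf s0 s1 Of.
have F0 := smooth_family_cst oD oU DU s0.
have F1 := smooth_family_cst oD oU DU s1.
have Fl := smooth_family_lambda (D := D).
have Fl1 := smooth_family_mul oD Fl F1.
have Ux : U x := DU _ Dx.
have [E0 E1] := Olambda2_jet Of Ux.
split; first by move: E0; rewrite mul0r addr0 => /eqP; rewrite subr_eq0 => /eqP.
move: E1; rewrite (dlambdaB Dx sf (smooth_family_add oD F0 Fl1)).
rewrite (dlambdaD Dx F0 Fl1) (dlambdaM Dx Fl F1) !dlambda_cst dlambda_lambda.
by rewrite mulr0 addr0 mul1r add0r => /eqP; rewrite subr_eq0 => /eqP.
Qed.

Section Fields.
Variables (D : set (R * 'rV[R]_n)).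
Hypothesis oD : open D.

Lemma smooth_family_d1 (A : R -> 'I_n -> 'rV[R]_n -> R) a b :
  (forall a, smooth_family_on D (fun la => A la a)) ->
  smooth_family_on D (fun la => d1 (A la) a b).
Proof.
move=> sA.
exact: (smooth_family_sub oD (smooth_family_pd a (sA b)) (smooth_family_pd b (sA a))).
Qed.

Lemma smooth_family_d2 (F : R -> 'I_n -> 'I_n -> 'rV[R]_n -> R) a b c :
  (forall a b, smooth_family_on D (fun la => F la a b)) ->
  smooth_family_on D (fun la => d2 (F la) a b c).
Proof.
move=> sF.
exact: (smooth_family_add oD (smooth_family_sub oD (smooth_family_pd a (sF b c))
  (smooth_family_pd b (sF a c))) (smooth_family_pd c (sF a b))).
Qed.

Lemma dlambda_d1 (A : R -> 'I_n -> 'rV[R]_n -> R) a b x : D (0, x) ->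
  (forall a, smooth_family_on D (fun la => A la a)) ->
  dlambda (fun la => d1 (A la) a b) x = d1 (fun a => dlambda (fun la => A la a)) a b x.
Proof.
move=> Dx sA; have sp i j := smooth_family_pd i (sA j).
rewrite (dlambdaB Dx (sp a b) (sp b a)).
by rewrite (dlambda_pd a oD Dx (sA b)) (dlambda_pd b oD Dx (sA a)).
Qed.

Lemma dlambda_d2 (F : R -> 'I_n -> 'I_n -> 'rV[R]_n -> R) a b c x : D (0, x) ->
  (forall a b, smooth_family_on D (fun la => F la a b)) ->
  dlambda (fun la => d2 (F la) a b c) x =
  d2 (fun a b => dlambda (fun la => F la a b)) a b c x.
Proof.
move=> Dx sF; have sp i j k := smooth_family_pd i (sF j k).
rewrite (dlambdaD Dx (smooth_family_sub oD (sp a b c) (sp b a c)) (sp c a b)).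
rewrite (dlambdaB Dx (sp a b c) (sp b a c)).
by rewrite (dlambda_pd a oD Dx (sF b c)) (dlambda_pd b oD Dx (sF a c)) (dlambda_pd c oD Dx (sF a b)).
Qed.
End Fields.
End FieldFamilies.

Section HodgeFamilies.
Context {R : realType}.
Variables (U : set 'rV[R]_4) (g : 'rV[R]_4 -> 'M[R]_4).
Hypothesis oU : open U.
Hypothesis sg : forall a b, smooth_on U (fun x => g x a b).
Hypothesis lor : forall x, U x -> lorentzian_form (g x).
Variable D : set (R * 'rV[R]_4).
Hypothesis oD : open D.
Hypothesis DU : forall z, D z -> U z.2.

Let gU x : U x -> g x \in unitmx. Proof. by move=> /lor /lorentzian_unit. Qed.

Let lift_family f : smooth_on U f -> smooth_family_on D (fun _ => f).
Proof. exact: smooth_family_cst oD oU DU. Qed.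

Let sginv a b : smooth_family_on D (fun _ => ginv g a b).
Proof. exact: lift_family (smooth_ginv oU sg gU a b). Qed.

Let sginv2 a b c d : smooth_family_on D (fun _ x => ginv g a c x * ginv g b d x).
Proof. exact: (smooth_family_mul oD (sginv a c) (sginv b d)). Qed.

Let svol a b c d : smooth_family_on D (fun _ => volume_form g a b c d).
Proof.
apply: (smooth_family_mul oD); first exact: lift_family (smooth_sqrt_det oU sg lor).
exact: smooth_family_const.
Qed.

Section Family.
Variable F : R -> 'I_4 -> 'I_4 -> 'rV[R]_4 -> R.
Hypothesis sF : forall a b, smooth_family_on D (fun la => F la a b).

Let sterm a b c d : smooth_family_on D (fun la x =>
  ginv g a c x * ginv g b d x * F la c d x).
Proof. exact: (smooth_family_mul oD (sginv2 a b c d) (sF c d)). Qed.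

Lemma smooth_family_raise2 a b : smooth_family_on D (fun la => raise2 g (F la) a b).
Proof.
apply: (smooth_family_bigsum oD) => c; apply: (smooth_family_bigsum oD) => d.
exact: sterm.
Qed.

(** The background metric does not depend on lambda, so index raising is linear with constant
    coefficients in lambda; [dlambda_hodge2] holds for the same reason. *)
Lemma dlambda_raise2 a b x : D (0, x) ->
  dlambda (fun la => raise2 g (F la) a b) x =
  raise2 g (fun c d => dlambda (fun la => F la c d)) a b x.
Proof.
move=> Dx; rewrite /raise2 (dlambda_sum oD Dx); last first.
  by move=> c; apply: (smooth_family_bigsum oD) => d; exact: sterm.
apply: eq_bigr => c _; rewrite (dlambda_sum oD Dx) => [|d]; last exact: sterm.
apply: eq_bigr => d _; rewrite (dlambdaM Dx (sginv2 a b c d) (sF c d)).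
by rewrite dlambda_cst mul0r add0r.
Qed.

Let hterm a b c d : smooth_family_on D (fun la x =>
  raise2 g (F la) c d x * volume_form g c d a b x).
Proof. exact: (smooth_family_mul oD (smooth_family_raise2 c d) (svol c d a b)). Qed.

Let hsum a b c : smooth_family_on D (fun la x =>
  \sum_d raise2 g (F la) c d x * volume_form g c d a b x).
Proof. by apply: (smooth_family_bigsum oD) => d; exact: hterm. Qed.

Let hsum2 a b : smooth_family_on D (fun la x =>
  \sum_c \sum_d raise2 g (F la) c d x * volume_form g c d a b x).
Proof. by apply: (smooth_family_bigsum oD) => c; exact: hsum. Qed.

Lemma smooth_family_hodge2 a b : smooth_family_on D (fun la => hodge2 g (F la) a b).
Proof. exact: (smooth_family_mul oD (smooth_family_const (2^-1)) (hsum2 a b)). Qed.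

Lemma dlambda_hodge2 a b x : D (0, x) ->
  dlambda (fun la => hodge2 g (F la) a b) x =
  hodge2 g (fun c d => dlambda (fun la => F la c d)) a b x.
Proof.
move=> Dx; rewrite /hodge2 (dlambdaM Dx (smooth_family_const _) (hsum2 a b)).
rewrite dlambda_cst mul0r add0r; congr (_ * _).
rewrite (dlambda_sum oD Dx _ _ (hsum a b)); apply: eq_bigr => c _.
rewrite (dlambda_sum oD Dx _ _ (hterm a b c)); apply: eq_bigr => d _.
rewrite (dlambdaM Dx (smooth_family_raise2 c d) (svol c d a b)) dlambda_cst mulr0 addr0.
by rewrite dlambda_raise2.
Qed.

End Family.

Lemma smooth_family_invs (F : R -> 'I_4 -> 'I_4 -> 'rV[R]_4 -> R) k :
  (forall a b, smooth_family_on D (fun la => F la a b)) ->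
  smooth_family_on D (fun la x => invs g (F la) x ord0 k).
Proof.
move=> sF.
have sFF (G : R -> 'I_4 -> 'I_4 -> 'rV[R]_4 -> R) :
    (forall a b, smooth_family_on D (fun la => G la a b)) ->
    smooth_family_on D (fun la x => \sum_a \sum_b F la a b x * raise2 g (G la) a b x).
  move=> sG; apply: (smooth_family_bigsum oD) => a; apply: (smooth_family_bigsum oD) => b.
  exact: (smooth_family_mul oD (sF a b) (smooth_family_raise2 sG a b)).
have sI : smooth_family_on D (fun la x =>
    if k == ord0 then Defs.invF g (F la) x else invG g (F la) x).
  case: (k == ord0); first exact: sFF sF.
  by apply: sFF => a b; exact: smooth_family_hodge2.
by apply: smooth_family_ext oD _ sI => z _; rewrite mxE.
Qed.

End HodgeFamilies.

Section HodgeSmooth.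
Context {R : realType}.
Variables (U : set 'rV[R]_4) (g : 'rV[R]_4 -> 'M[R]_4).
Hypothesis oU : open U.
Hypothesis sg : forall a b, smooth_on U (fun x => g x a b).
Hypothesis lor : forall x, U x -> lorentzian_form (g x).
Variable F : 'I_4 -> 'I_4 -> 'rV[R]_4 -> R.
Hypothesis sF : forall a b, smooth_on U (F a b).

(** Smoothness for a single form is read off from the result for families, applied to the constant
    family on R x U. *)
Let D : set (R * 'rV[R]_4) := [set z | U z.2].
Let oD : open D. Proof. by apply: open_comp oU => z _; exact: cvg_snd. Qed.
Let D_0 x : U x -> D (0, x). Proof. by []. Qed.
Let DU z : D z -> U z.2. Proof. by []. Qed.
Let sFD a b : smooth_family_on D (fun _ => F a b).
Proof. exact: (smooth_family_cst oD oU DU (sF a b)). Qed.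

Lemma smooth_hodge2 a b : smooth_on U (hodge2 g F a b).
Proof.
exact: (smooth_slice oD oU D_0 (smooth_family_hodge2 oU sg lor oD DU sFD a b)).
Qed.

Lemma smooth_invs k : smooth_on U (fun x => invs g F x ord0 k).
Proof.
exact: (smooth_slice oD oU D_0 (smooth_family_invs oU sg lor oD DU k sFD)).
Qed.

End HodgeSmooth.

(** The assumption concerns one point only, so k, p and q may be values at x of functions, as L_F
    and L_G are in [Zform]. *)
Lemma hodge2_lin {R : realType} (g : 'rV[R]_4 -> 'M[R]_4) (k p q : R)
    (F F1 F2 : 'I_4 -> 'I_4 -> 'rV[R]_4 -> R) a b x :
  (forall c d, F c d x = k * (p * F1 c d x + q * F2 c d x)) ->
  hodge2 g F a b x = k * (p * hodge2 g F1 a b x + q * hodge2 g F2 a b x).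
Proof.
move=> E; rewrite /hodge2 (mulrCA p) (mulrCA q) -mulrDr (mulrCA k); congr (_ * _).
rewrite (mulr_sumr _ _ _ p) (mulr_sumr _ _ _ q) -big_split mulr_sumr; apply: eq_bigr => c _ /=.
rewrite (mulr_sumr _ _ _ p) (mulr_sumr _ _ _ q) -big_split mulr_sumr; apply: eq_bigr => d _ /=.
have -> : raise2 g F c d x = k * (p * raise2 g F1 c d x + q * raise2 g F2 c d x).
  rewrite /raise2 !mulr_sumr -big_split /= mulr_sumr; apply: eq_bigr => e _.
  rewrite !mulr_sumr -big_split /= mulr_sumr; apply: eq_bigr => f _.
  by rewrite E; ring.
have distr (r1 r2 w : R) : k * (p * r1 + q * r2) * w = k * (p * (r1 * w) + q * (r2 * w)).
  by ring.
exact: distr.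
Qed.

Lemma raise2_ext {R : realType} {n} (g : 'rV[R]_n -> 'M[R]_n) (F G : 'I_n -> 'I_n -> 'rV[R]_n -> R) a b x :
  (forall c d, F c d x = G c d x) -> raise2 g F a b x = raise2 g G a b x.
Proof. by move=> FG; apply: eq_bigr => c _; apply: eq_bigr => d _; rewrite FG. Qed.

Lemma hodge2_ext {R : realType} (g : 'rV[R]_4 -> 'M[R]_4) (F G : 'I_4 -> 'I_4 -> 'rV[R]_4 -> R) a b x :
  (forall c d, F c d x = G c d x) -> hodge2 g F a b x = hodge2 g G a b x.
Proof.
move=> FG; rewrite /hodge2; congr (_ * _); apply: eq_bigr => c _; apply: eq_bigr => d _.
by rewrite (raise2_ext _ _ _ FG).
Qed.

Lemma invs_ext {R : realType} (g : 'rV[R]_4 -> 'M[R]_4) (F G : 'I_4 -> 'I_4 -> 'rV[R]_4 -> R) x :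
  (forall c d, F c d x = G c d x) -> invs g F x = invs g G x.
Proof.
move=> FG; apply/rowP => k; rewrite !mxE /Defs.invF /invG; case: ifP => _.
  by apply: eq_bigr => a _; apply: eq_bigr => b _; rewrite FG (raise2_ext _ _ _ FG).
apply: eq_bigr => a _; apply: eq_bigr => b _; rewrite FG.
by congr (_ * _); apply: raise2_ext => c d; exact: hodge2_ext.
Qed.

(** * Test fields on a vacuum background *)

Definition Jeff_potential {R : realType} (g : 'rV[R]_4 -> 'M[R]_4) (l : 'rV[R]_2 -> R)
    (K : 'I_4 -> 'rV[R]_4 -> R) a b (y : 'rV[R]_4) :=
  let F0 := d1 (flat g K) in
  4 * (dcalF l (invs g F0 y) * hodge2 g F0 a b y) - 4 * (dcalG l (invs g F0 y) * F0 a b y).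

Section KillingField.
Context {R : realType}.
Variables (U : set 'rV[R]_4) (g : 'rV[R]_4 -> 'M[R]_4) (K : 'I_4 -> 'rV[R]_4 -> R).
Variable l : 'rV[R]_2 -> R.
Hypothesis oU : open U.
Hypothesis sg : forall a b, smooth_on U (fun x => g x a b).
Hypothesis lor : forall x, U x -> lorentzian_form (g x).
Hypothesis vacuum : forall x, U x -> forall a b, ricci g a b x = 0.
Hypothesis sK : forall a, smooth_on U (K a).
Hypothesis killing : forall x, U x -> forall a b, lie_metric g K a b x = 0.
Hypothesis sl : smooth_on setT l.

Let gT x : U x -> (g x)^T = g x. Proof. by move=> /lor []. Qed.
Let gU x : U x -> g x \in unitmx. Proof. by move=> /lor /lorentzian_unit. Qed.

Local Notation F0 := (d1 (flat g K)).
Local Notation G := (Jeff_potential g l K).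
Let u0 := invs g F0.
Let f1 x := dcalF l (u0 x).
Let f2 x := dcalG l (u0 x).

Let sflat a : smooth_on U (flat g K a).
Proof. exact: (smooth_flat oU sg sK a). Qed.

Let sF0 a b : smooth_on U (F0 a b).
Proof. exact: (smooth_d1 oU a b sflat). Qed.

Let shF0 a b : smooth_on U (hodge2 g F0 a b).
Proof. exact: (smooth_hodge2 oU sg lor sF0 a b). Qed.

Let su0 k : smooth_on U (fun x => u0 x ord0 k).
Proof. exact: (smooth_invs oU sg lor sF0 k). Qed.

Let sf1 : smooth_on U f1.
Proof. exact: (smooth_comp oU openT (fun _ _ => I) (smooth_pd ord0 sl) su0). Qed.

Let sf2 : smooth_on U f2.
Proof. exact: (smooth_comp oU openT (fun _ _ => I) (smooth_pd ord_max sl) su0). Qed.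

Lemma killing_maxwell a b c x : U x -> d2 (hodge2 g F0) a b c x = 0.
Proof.
move=> Ux; apply: (d2_hodge2_eq0 oU sg lor sF0 (@d1_antisym _ _ _) a b c Ux) => d.
apply: (div_raise2_d1_flat oU sg gT gU sK killing Ux d (smooth_sqrt_det oU sg lor)).
  by move=> e; exact: (pd_sqrt_det oU sg lor e Ux).
exact: vacuum.
Qed.

Let d2F0 a b c x : U x -> d2 F0 a b c x = 0.
Proof. by move=> Ux; exact: (d2_d1 oU a b c Ux sflat). Qed.

Let pd_u0 (h : 'rV[R]_2 -> R) e x : U x -> smooth_on setT h ->
  pd e (fun y => h (u0 y)) x =
  dcalF h (u0 x) * d0 (Defs.invF g F0) e x + dcalG h (u0 x) * d0 (invG g F0) e x.
Proof.
move=> Ux sh; rewrite (pd_comp e openT I sh su0 Ux) !big_ord_recl big_ord0 addr0.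
have -> : lift ord0 ord0 = ord_max :> 'I_2 by exact: val_inj.
have -> : (fun y => u0 y ord0 ord0) = Defs.invF g F0 by apply/funext => y; rewrite mxE.
by have -> : (fun y => u0 y ord0 ord_max) = invG g F0 by apply/funext => y; rewrite mxE.
Qed.

Let sG1 a b : smooth_on U (fun y => f1 y * hodge2 g F0 a b y).
Proof. exact: (smooth_mul oU sf1 (shF0 a b)). Qed.

Let sG2 a b : smooth_on U (fun y => f2 y * F0 a b y).
Proof. exact: (smooth_mul oU sf2 (sF0 a b)). Qed.

Let s4G1 a b : smooth_on U (fun y => 4 * (f1 y * hodge2 g F0 a b y)).
Proof. exact: (smooth_mul oU (@smooth_cst R 4 U 4) (sG1 a b)). Qed.

Let s4G2 a b : smooth_on U (fun y => 4 * (f2 y * F0 a b y)).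
Proof. exact: (smooth_mul oU (@smooth_cst R 4 U 4) (sG2 a b)). Qed.

Lemma smooth_Jeff_potential a b : smooth_on U (G a b).
Proof. exact: (smooth_sub oU (s4G1 a b) (s4G2 a b)). Qed.

(* [*J_eff] is exact since [F0] and [*F0] are closed. *)
Lemma starJeff_exact a b c x : U x -> starJeff g l (flat g K) a b c x = d2 G a b c x.
Proof.
move=> Ux.
rewrite (d2B a b c Ux s4G1 s4G2) (d2Z 4 a b c Ux sG1) (d2Z 4 a b c Ux sG2).
rewrite (d2_scale a b c Ux sf1 shF0) (d2_scale a b c Ux sf2 sF0).
rewrite (killing_maxwell a b c Ux) (d2F0 a b c Ux) !mulr0 !addr0.
have E1 e := pd_u0 e Ux (smooth_pd ord0 sl).
have E2 e := pd_u0 e Ux (smooth_pd ord_max sl).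
by rewrite /starJeff /wedge12 /d0 !E1 !E2.
Qed.

Lemma starJeff_closed a b c d x : U x -> d3 (starJeff g l (flat g K)) a b c d x = 0.
Proof.
move=> Ux; rewrite (d3_ext oU a b c d Ux starJeff_exact).
exact: (d3_d2 oU a b c d Ux smooth_Jeff_potential).
Qed.

End KillingField.

(** * The perturbed field and its first-order equation *)

Section TestField.
Context {R : realType}.
Variables (U : set 'rV[R]_4) (g : 'rV[R]_4 -> 'M[R]_4) (K : 'I_4 -> 'rV[R]_4 -> R).
Variables (L : R -> 'rV[R]_2 -> R) (DL : set (R * 'rV[R]_2)) (l : 'rV[R]_2 -> R).
Variables (v : 'I_4 -> 'rV[R]_4 -> R) (eps : R) (A : R -> 'I_4 -> 'rV[R]_4 -> R).
Hypothesis oU : open U.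
Hypothesis sg : forall a b, smooth_on U (fun x => g x a b).
Hypothesis lor : forall x, U x -> lorentzian_form (g x).
Hypothesis vacuum : forall x, U x -> forall a b, ricci g a b x = 0.
Hypothesis sK : forall a, smooth_on U (K a).
Hypothesis killing : forall x, U x -> forall a b, lie_metric g K a b x = 0.
Hypothesis sl : smooth_on setT l.
Hypothesis oDL : open DL.
Hypothesis DL0 : forall u, DL (0, u).
Hypothesis sL : smooth_family_on DL L.
Hypothesis L_exp : Olambda2 setT (fun la u =>
  L la u - (- 4^-1 * u ord0 ord0 + la * l u)).
Hypothesis sv : forall a, smooth_on U (v a).
Hypothesis eps0 : 0 < eps.
Let D0 : set (R * 'rV[R]_4) := [set z | `|z.1| < eps /\ U z.2].
Hypothesis sA : forall a, smooth_family_on D0 (fun la => A la a).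
Hypothesis A_exp : forall a, Olambda2 U (fun la x =>
  A la a x - (flat g K a x + la * v a x)).

Local Notation F0 := (d1 (flat g K)).
Let u0 := invs g F0.
Local Notation G := (Jeff_potential g l K).

Let oD0 : open D0.
Proof.
apply: openI; last by apply: open_comp oU => z _; exact: cvg_snd.
apply: (@open_comp _ _ (fun z : R * 'rV[R]_4 => `|z.1|) [set r | r < eps]).
  by move=> z _; apply: continuous_comp; [exact: cvg_fst|exact: norm_continuous].
exact: open_lt.
Qed.

Let D0_0 x : U x -> D0 (0, x).
Proof. by move=> Ux; split=> //=; rewrite normr0. Qed.

Let D0U z : D0 z -> U z.2. Proof. by case. Qed.

Let sflat a : smooth_on U (flat g K a).
Proof. exact: (smooth_flat oU sg sK a). Qed.

Let sG a b : smooth_on U (G a b).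
Proof. exact: (smooth_Jeff_potential oU sg lor sK sl a b). Qed.

Lemma bianchi la a b c x : `|la| < eps -> U x -> d2 (d1 (A la)) a b c x = 0.
Proof.
move=> lae Ux; apply: (d2_d1 oU a b c Ux) => e.
by apply: (smooth_slice oD0 oU _ (sA e)) => y Uy; split.
Qed.

Let A0 a x : U x -> A 0 a x = flat g K a x.
Proof.
move=> Ux; exact: (affine_jet oD0 oU D0U (D0_0 Ux) (sA a) (sflat a) (sv a) (A_exp a)).1.
Qed.

Let dA a x : U x -> dlambda (fun la => A la a) x = v a x.
Proof.
move=> Ux; exact: (affine_jet oD0 oU D0U (D0_0 Ux) (sA a) (sflat a) (sv a) (A_exp a)).2.
Qed.

Let sLin : smooth_on setT (fun u : 'rV[R]_2 => - 4^-1 * u ord0 ord0).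
Proof. exact: (smooth_mul openT (@smooth_cst R 2 setT _) (@smooth_coord R 2 setT ord0)). Qed.

(** An equality of functions on the whole plane, available because [DL] contains every (0, u); it
    can therefore be differentiated in the invariants. *)
Let L0 : L 0 = (fun u => - 4^-1 * u ord0 ord0).
Proof.
by apply/funext => u; exact: (affine_jet oDL openT (fun _ _ => I) (DL0 u) sL sLin sl L_exp).1.
Qed.

Let dL : dlambda L = l.
Proof.
by apply/funext => u; exact: (affine_jet oDL openT (fun _ _ => I) (DL0 u) sL sLin sl L_exp).2.
Qed.

Let dcalF_L0 u : dcalF (L 0) u = - 4^-1.
Proof.
rewrite /dcalF L0 (pdZ (U := setT) I ord0 _ (@smooth_coord R 2 setT ord0)) pd_coord.
by rewrite eqxx mulr1.
Qed.

Let dcalG_L0 u : dcalG (L 0) u = 0.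
Proof.
rewrite /dcalG L0 (pdZ (U := setT) I ord_max _ (@smooth_coord R 2 setT ord0)) pd_coord.
by rewrite mulr0.
Qed.

Let F la := d1 (A la).
Let u la := invs g (F la).

Let sF a b : smooth_family_on D0 (fun la => F la a b).
Proof. exact: (smooth_family_d1 oD0 a b sA). Qed.

Let su k : smooth_family_on D0 (fun la x => u la x ord0 k).
Proof. exact: (smooth_family_invs oU sg lor oD0 D0U k sF). Qed.

Let F_0 a b x : U x -> F 0 a b x = F0 a b x.
Proof. by move=> Ux; exact: (d1_ext oU a b Ux A0). Qed.

Let u_0 x : U x -> u 0 x = u0 x.
Proof. by move=> Ux; apply: invs_ext => a b; exact: F_0. Qed.

(** The set where L is known to be smooth at the invariants of the field. Its width in lambda may
    depend on x, but it is open and contains every (0, x) with x in U. *)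
Let D : set (R * 'rV[R]_4) := [set z | D0 z /\ DL (z.1, u z.1 z.2)].

Let oD : open D. Proof. exact: comp_dom_open. Qed.

Let DU z : D z -> U z.2. Proof. by case=> /D0U. Qed.

Let D_0 x : U x -> D (0, x).
Proof. by move=> Ux; split; [exact: D0_0|exact: DL0]. Qed.

Let toD f : smooth_family_on D0 f -> smooth_family_on D f.
Proof. by apply: smooth_subset => z []. Qed.

Let P la x := dcalF (L la) (u la x).
Let Q la x := dcalG (L la) (u la x).

Let suD k : smooth_family_on D (fun la x => u la x ord0 k).
Proof. exact: toD (su k). Qed.

Let sP : smooth_family_on D P.
Proof. by apply: (smooth_family_comp oD oDL (smooth_family_pd ord0 sL) suD) => z []. Qed.

Let sQ : smooth_family_on D Q.
Proof. by apply: (smooth_family_comp oD oDL (smooth_family_pd ord_max sL) suD) => z []. Qed.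

Let P_0 x : P 0 x = - 4^-1. Proof. exact: dcalF_L0. Qed.
Let Q_0 x : Q 0 x = 0. Proof. exact: dcalG_L0. Qed.

(** At lambda = 0 the derivatives of L are constants, so the lambda-dependence of the invariants
    drops out of the chain rule and only the explicit term l_F or l_G at the field dK survives. *)
Let dlambda_comp_L (i : 'I_2) (k : R) x : U x -> (forall w, pd i (L 0) w = k) ->
  dlambda (fun la x => pd i (L la) (u la x)) x = pd i l (u0 x).
Proof.
move=> Ux Lk.
rewrite (dlambda_comp oDL (smooth_family_pd i sL) suD (D_0 Ux) (DL0 _)).
rewrite big1 ?addr0 => [|j _].
  by rewrite (dlambda_pd i oDL (DL0 _) sL) dL u_0.
rewrite (_ : pd i (L 0) = fun=> k) ?pd_cst ?mul0r //.
by apply/funext => w; exact: Lk.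
Qed.

Let dP x : U x -> dlambda P x = dcalF l (u0 x).
Proof. by move=> Ux; exact: (dlambda_comp_L Ux dcalF_L0). Qed.

Let dQ x : U x -> dlambda Q x = dcalG l (u0 x).
Proof. by move=> Ux; exact: (dlambda_comp_L Ux dcalG_L0). Qed.

Let sFD a b : smooth_family_on D (fun la => F la a b).
Proof. exact: toD (sF a b). Qed.

Let shF a b : smooth_family_on D (fun la => hodge2 g (F la) a b).
Proof. exact: (smooth_family_hodge2 oU sg lor oD DU sFD a b). Qed.

Let N la a b (x : 'rV[R]_4) := - 4 * (P la x * hodge2 g (F la) a b x - Q la x * F la a b x).

Let sPh a b : smooth_family_on D (fun la x => P la x * hodge2 g (F la) a b x).
Proof. exact: (smooth_family_mul oD sP (shF a b)). Qed.

Let sQF a b : smooth_family_on D (fun la x => Q la x * F la a b x).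
Proof. exact: (smooth_family_mul oD sQ (sFD a b)). Qed.

Let sN a b : smooth_family_on D (fun la => N la a b).
Proof.
exact: (smooth_family_mul oD (smooth_family_const (- 4)) (smooth_family_sub oD (sPh a b) (sQF a b))).
Qed.

(* [*Z = -4 (L_F *F - L_G F)] because [**F = -F]. *)
Let hodge2_Zform la a b x : U x -> hodge2 g (Zform g (L la) (F la)) a b x = N la a b x.
Proof.
move=> Ux.
rewrite (@hodge2_lin R g (- 4) (P la x) (Q la x) _ (F la) (hodge2 g (F la))) //.
by rewrite (hodge2_hodge2 lor a b Ux (fun c d => d1_antisym _ c d x)) mulrN.
Qed.

Let N_0 a b x : U x -> N 0 a b x = hodge2 g F0 a b x.
Proof.
move=> Ux; rewrite /N P_0 Q_0 mul0r subr0 mulrA mulrNN mulfV ?mul1r; last by rewrite pnatr_eq0.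
by apply: hodge2_ext => c d; exact: F_0.
Qed.

Let dhF a b x : U x -> dlambda (fun la => hodge2 g (F la) a b) x = hodge2 g (d1 v) a b x.
Proof.
move=> Ux; rewrite (dlambda_hodge2 oU sg lor oD DU sFD a b (D_0 Ux)).
apply: hodge2_ext => c d.
rewrite (dlambda_d1 oD0 c d (D0_0 Ux) sA).
exact: (d1_ext oU c d Ux dA).
Qed.

(** In the product rule the variation of F carries the coefficients -4 P = 1 and Q = 0 at lambda =
    0, hence enters only as the dual of dv; the variations of P and Q multiply the unperturbed
    field. *)
Let dN a b x : U x -> dlambda (fun la => N la a b) x = hodge2 g (d1 v) a b x - G a b x.
Proof.
move=> Ux; have Dx := D_0 Ux.
rewrite (dlambdaM Dx (smooth_family_const (- 4)) (smooth_family_sub oD (sPh a b) (sQF a b))).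
rewrite dlambda_cst mul0r add0r (dlambdaB Dx (sPh a b) (sQF a b)).
rewrite (dlambdaM Dx sP (shF a b)) (dlambdaM Dx sQ (sFD a b)) dP // dQ // P_0 Q_0 dhF //.
rewrite (F_0 a b Ux) (hodge2_ext g a b (fun c d => F_0 c d Ux)) mul0r addr0.
have alg (p h q f w : R) : - 4 * (p * h + - 4^-1 * w - q * f) = w - (4 * (p * h) - 4 * (q * f)).
  by field.
exact: alg.
Qed.

Let shv a b : smooth_on U (hodge2 g (d1 v) a b).
Proof.
have sv1 c d : smooth_family_on D0 (fun _ => d1 v c d).
  exact: (smooth_family_cst oD0 oU D0U (smooth_d1 oU c d sv)).
exact: (smooth_slice oD0 oU D0_0 (smooth_family_hodge2 oU sg lor oD0 D0U sv1 a b)).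
Qed.

Let d2N_0 a b c x : U x -> d2 (N 0) a b c x = 0.
Proof.
by move=> Ux; rewrite (d2_ext oU a b c Ux N_0); exact: (killing_maxwell oU sg lor vacuum sK killing).
Qed.

Let dlambda_d2N a b c x : U x -> dlambda (fun la => d2 (N la) a b c) x =
  d2 (hodge2 g (d1 v)) a b c x - starJeff g l (flat g K) a b c x.
Proof.
move=> Ux; rewrite (dlambda_d2 oD a b c (D_0 Ux) sN) (d2_ext oU a b c Ux dN).
by rewrite (d2B a b c Ux shv sG) (starJeff_exact oU sg lor vacuum sK killing sl a b c Ux).
Qed.

(** Valid for every lambda, as [Olambda2_ext] asks, because the identity for the double dual is
    algebraic in F. *)
Let field_equation_family a b c la x : U x ->
  d2 (hodge2 g (Zform g (L la) (d1 (A la)))) a b c x = d2 (N la) a b c x.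
Proof. by move=> Ux; exact: (d2_ext oU a b c Ux (hodge2_Zform la)). Qed.

Lemma field_equation_iff a b c :
  Olambda2 U (fun la => d2 (hodge2 g (Zform g (L la) (d1 (A la)))) a b c) <->
  (forall x, U x -> d2 (hodge2 g (d1 v)) a b c x = starJeff g l (flat g K) a b c x).
Proof.
split=> [EqZ x Ux|E].
  have [_] := Olambda2_jet (Olambda2_ext oU (field_equation_family a b c) EqZ) Ux.
  by rewrite dlambda_d2N // => /eqP; rewrite subr_eq0 => /eqP.
apply: (Olambda2_ext oU (fun la x Ux => esym (field_equation_family a b c la Ux))).
apply: (Olambda2_intro oD oU D_0 (smooth_family_d2 oD a b c sN) (d2N_0 a b c)) => x Ux.
by rewrite dlambda_d2N // E // subrr.
Qed.

End TestField.

Theorem mainTheorem1 (R : realType) (M : oriented_manifold R 4)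
  (g : chart_index M -> 'rV[R]_4 -> 'M[R]_4)
  (K : chart_index M -> 'I_4 -> 'rV[R]_4 -> R)
  (L : R -> 'rV[R]_2 -> R) (D : set (R * 'rV[R]_2)) (l : 'rV[R]_2 -> R)
  (v : chart_index M -> 'I_4 -> 'rV[R]_4 -> R)
  (eps : R) (A : R -> chart_index M -> 'I_4 -> 'rV[R]_4 -> R)
  (g_metric : is_lorentzian_metric g)
  (g_vacuum : forall i x, chart_codom i x ->
     forall a b, ricci (g i) a b x = 0)
  (K_field : is_vector_field K)
  (K_killing : forall i x, chart_codom i x ->
     forall a b, lie_metric (g i) (K i) a b x = 0)
  (l_smooth : smooth_on setT l)
  (D_open : open D) (D_zero : forall u, D (0, u))
  (L_smooth : smooth_family_on D L)
  (L_expansion : Olambda2 setT (fun la u =>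
     L la u - (- 4^-1 * u ord0 ord0 + la * l u)))
  (v_form : is_1form v)
  (eps_gt0 : 0 < eps) (A_form : is_1form_family eps A)
  (A_expansion : forall i a, Olambda2 (chart_codom i) (fun la x =>
     A la i a x - (flat (g i) (K i) a x + la * v i a x))) :
  [/\ (forall la, `|la| < eps -> forall i x, chart_codom i x ->
         forall a b c, d2 (d1 (A la i)) a b c x = 0),
      (forall i a b c, Olambda2 (chart_codom i) (fun la =>
         d2 (hodge2 (g i) (Zform (g i) (L la) (d1 (A la i)))) a b c))
      <->
      (forall i x, chart_codom i x -> forall a b c,
         d2 (hodge2 (g i) (d1 (v i))) a b c x
         = starJeff (g i) l (flat (g i) (K i)) a b c x) &
      (forall i x, chart_codom i x -> forall a b c d,
         d3 (starJeff (g i) l (flat (g i) (K i))) a b c d x = 0)].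
Proof.
have [_ sg lor] := g_metric.
have [_ sK] := K_field; have [_ sv] := v_form; have [_ sA] := A_form.
split.
- move=> la lae i x Ux a b c.
  exact: (bianchi (@chart_codom_open _ _ M i) (sA i) a b c lae Ux).
- have iff i := field_equation_iff (@chart_codom_open _ _ M i) (sg i) (lor i)
    (g_vacuum i) (sK i) (K_killing i) l_smooth D_open D_zero L_smooth L_expansion
    (sv i) eps_gt0 (sA i) (A_expansion i).
  split=> [EqZ i x Ux a b c|E i a b c].
    exact: (iff i a b c).1 (EqZ i a b c) x Ux.
  by apply: (iff i a b c).2 => x Ux; exact: E.
- move=> i x Ux a b c d.
  exact: (starJeff_closed (@chart_codom_open _ _ M i) (sg i) (lor i)
    (g_vacuum i) (sK i) (K_killing i) l_smooth a b c d Ux).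
Qed.
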